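(* Let $n\ge 2$ be even. (i) There exists $\varepsilon_n>0$ such that every set $P=\{v_1,\dots,v_{n/2},w_1,\dots,w_{n/2}\}$ that is generic and in convex position, where $v_i$ lies within distance $\varepsilon_n$ of $(i,0)$ and $w_i$ lies within distance $\varepsilon_n$ of $(i,1)$ for all $i$, satisfies $\operatorname{cr}(P)\ge \lfloor \tfrac58 (n-2)\rfloor$. (ii) For every $\varepsilon>0$ there exists such a set $P_0$ (generic, in convex position, with $v_i$ within distance $\varepsilon$ of $(i,0)$ and $w_i$ within distance $\varepsilon$ of $(i,1)$) with $\operatorname{cr}(P_0)\le \lfloor \tfrac58 (n-2)\rfloor$.
   Context: The $2\times\frac n2$ grid is the set of points $(i,0)$ and $(i,1)$ for $i=1,\dots,n/2$; a perturbation of it is obtained by moving each grid point by a sufficiently small amount. A finite planar point set is in general position if no three of its points are collinear. It is generic if it is in general position and every subset of it has a unique (Euclidean) minimum spanning tree (MST); for a generic set $X$, $T_X$ denotes the MST of $X$, drawn with straight-line edges. For disjoint point sets $R,B$ with $R\cup B$ generic, $\operatorname{cr}(R,B)$ denotes the number of crossings between the edges of $T_R$ and the edges of $T_B$. For a generic point set $P$, $\operatorname{cr}(P)=\max \operatorname{cr}(R,B)$, the maximum over all partitions $P=R\cup B$ into two disjoint sets. *)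

(* Defs.v *)
From HB Require Import structures.
From mathcomp Require Import all_boot all_order all_algebra.
From mathcomp Require Import boolp reals.
Set Implicit Arguments. Unset Strict Implicit. Unset Printing Implicit Defensive.
Import Order.TTheory GRing.Theory Num.Theory.
Local Open Scope ring_scope.

Section PlaneGeometry.
Variable R : realType.
Notation pt := (R * R)%type.

Definition dist (a b : pt) : R :=
  Num.sqrt ((a.1 - b.1) ^+ 2 + (a.2 - b.2) ^+ 2).

Definition collinear (a b c : pt) : Prop :=
  (b.1 - a.1) * (c.2 - a.2) - (b.2 - a.2) * (c.1 - a.1) = 0.

Definition seg_intersect (a b c d : pt) : Prop :=
  exists s t : R, [/\ 0 <= s <= 1, 0 <= t <= 1,
    a.1 + s * (b.1 - a.1) = c.1 + t * (d.1 - c.1) &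
    a.2 + s * (b.2 - a.2) = c.2 + t * (d.2 - c.2)].

Variable I : finType.
Variable p : I -> pt.   (* the point set is the image of p (p injective) *)

Definition general_position : Prop :=
  forall x y z : I, x != y -> y != z -> x != z -> ~ collinear (p x) (p y) (p z).

Definition convex_position : Prop :=
  forall x : I, ~ exists lam : I -> R,
    [/\ forall y, 0 <= lam y, lam x = 0, \sum_y lam y = 1,
        \sum_y lam y * (p y).1 = (p x).1 & \sum_y lam y * (p y).2 = (p x).2].

(* Graphs on I: an edge set is a set of 2-element subsets of I *)
Definition edge_rel (E : {set {set I}}) : rel I := fun x y => [set x; y] \in E.

Definition spanning_tree (S : {set I}) (E : {set {set I}}) : bool :=
  [&& E \subset [set e : {set I} | (#|e| == 2) && (e \subset S)],
      #|E| == #|S|.-1 &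
      [forall x in S, forall y in S, connect (edge_rel E) x y]].

Definition edge_len (e : {set I}) : R :=
  (\sum_(x in e) \sum_(y in e) dist (p x) (p y)) / 2.

Definition weight (E : {set {set I}}) : R := \sum_(e in E) edge_len e.

Definition is_mst (S : {set I}) (E : {set {set I}}) : bool :=
  spanning_tree S E &&
  [forall E' : {set {set I}}, spanning_tree S E' ==> (weight E <= weight E')].

Definition generic : Prop :=
  general_position /\ forall S : {set I}, exists! E, is_mst S E.

Definition edges_cross (e f : {set I}) : Prop :=
  exists a b c d : I, [/\ e = [set a; b], f = [set c; d] &
    seg_intersect (p a) (p b) (p c) (p d)].

Definition crossings (ER EB : {set {set I}}) : nat :=
  #|[set ef : {set I} * {set I} |
       [&& ef.1 \in ER, ef.2 \in EB & `[< edges_cross ef.1 ef.2 >]]]|.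

(* cr(R,B): crossings between T_R and T_B (the MSTs are unique for generic
   point sets, so the max below ranges over a single pair) *)
Definition cr_RB (Rs Bs : {set I}) : nat :=
  \max_(ER in [set E | is_mst Rs E]) \max_(EB in [set E | is_mst Bs E])
     crossings ER EB.

Definition cr : nat := \max_(Rs : {set I}) cr_RB Rs (~: Rs).

End PlaneGeometry.

(* The perturbed 2 x (n/2) grid: v_i near (i,0), w_i near (i,1), i = 1..n/2
   (index i : 'I_m stands for i+1). *)
Definition grid_pts (R : realType) (m : nat) (v w : 'I_m -> R * R)
  : 'I_m + 'I_m -> R * R :=
  fun x => match x with inl i => v i | inr i => w i end.

Definition near_grid (R : realType) (m : nat) (eps : R) (v w : 'I_m -> R * R)
  : Prop :=
  forall i : 'I_m, dist (v i) (i.+1%:R, 0) <= eps /\ dist (w i) (i.+1%:R, 1) <= eps.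

(* Main.v *)
(**
Close to the grid, an edge of the minimum spanning tree of a set [S] is either
vertical or joins two consecutive columns met by [S], and it is slanted only if
both of these columns contain a single point of [S]. In convex position, two
edges cross exactly when their ends alternate along the boundary.

Lower bound: four steps carry five crossings. Give columns 1 and 3 one colour and
column 2 the other; columns 1 and 3 are joined in the row [h] where this is
shorter. Columns 0 and 4 get, in row [h], the colour of column 2. The edge of row
[h] between columns 1 and 3 then crosses the vertical edge of column 2 and the two
edges joining column 2 to row [h] of columns 0 and 4, and these two cross the
vertical edges of columns 1 and 3. Choosing the colours of columns 1, 2, 3 by [h],
columns 0 and 4 are the same for both values of [h], so gadgets can be chained.

Upper bound: take a perturbation in which vertical edges are longer than unit
horizontal edges, their lengths decrease to the right, and the row of the shorter
edge between columns [i] and [j >= i + 2] is given by the parity of [j]. A maximal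
run of columns of one colour then carries one vertical edge, crossed by the edge of
the other colour jumping over the run. Two jumps over adjacent runs cross when they
use the same row, and parity forbids this for runs of length one in the middle of
a sequence of runs. Charging crossings to right ends gives at most 5/4 per step.
*)
Require Import Defs.
From HB Require Import structures.
From mathcomp Require Import all_boot all_order all_algebra.
From mathcomp Require Import boolp reals.
From mathcomp Require Import zify ring lra.
Set Implicit Arguments. Unset Strict Implicit. Unset Printing Implicit Defensive.
Import Order.TTheory GRing.Theory Num.Theory.
Local Open Scope ring_scope.

(** * Exchange in minimum spanning trees *)

Section EdgeSets.
Variables (R : realType) (I : finType) (p : I -> R * R).
Implicit Types (S A : {set I}) (E : {set {set I}}) (x y z u v : I).

Lemma set2_eq x y u v :
  [set x; y] = [set u; v] -> (x = u /\ y = v) \/ (x = v /\ y = u).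
Proof.
move=> /setP exy; have := (exy x, exy y, exy u, exy v).
rewrite !inE !eqxx !orbT /=.
case=> [[[]]] /esym/orP[]/eqP ? /esym/orP[]/eqP ? /orP[]/eqP ? /orP[]/eqP ?; subst;
  by [left | right].
Qed.

Lemma edge_rel_sym E : symmetric (edge_rel E).
Proof. by move=> x y; rewrite /edge_rel setUC. Qed.

Lemma connectC E x y : connect (edge_rel E) x y = connect (edge_rel E) y x.
Proof. exact: (sym_connect_sym (edge_rel_sym E)). Qed.

Lemma path_crosses (e : rel I) A x s :
  path e x s -> x \in A -> last x s \notin A ->
  exists u v, [/\ e u v, u \in A & v \notin A].
Proof.
elim: s x => [|y s IHs] x /=; first by move=> _ ->.
case/andP=> exy ps xA lA; have [yA|yA] := boolP (y \in A); first exact: IHs ps yA lA.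
by exists x, y.
Qed.

Lemma connect_crosses (e : rel I) A x y :
  connect e x y -> x \in A -> y \notin A ->
  exists u v, [/\ e u v, u \in A & v \notin A].
Proof. by case/connectP=> s ps ->; apply: path_crosses ps. Qed.

(* A maximal vertex set V containing x0 and spanned by at least |V| - 1 edges
   of E cannot be left by an edge of E. *)
Lemma card_connected S E :
  {in S &, forall x y, connect (edge_rel E) x y} -> (#|S|.-1 <= #|E|)%N.
Proof.
have [->|[x0 x0S]] := set_0Vmem S; first by rewrite cards0.
move=> conS.
pose Q (V : {set I}) := (x0 \in V) && (#|V|.-1 <= #|[set e in E | e \subset V]|)%N.
have Q0 : Q [set x0] by rewrite /Q set11 cards1.
case: (arg_maxnP (fun V : {set I} => #|V|) Q0) => V /andP[x0V cV] Vmax.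
have SV : S \subset V.
  apply/subsetP=> y yS; apply/negPn/negP=> yV.
  have [u [v [euv uV vV]]] := connect_crosses (conS x0 y x0S yS) x0V yV.
  have : Q (v |: V).
    rewrite /Q in_setU1 x0V orbT cardsU1 vV /=.
    have V0 : (0 < #|V|)%N by apply/card_gt0P; exists x0.
    apply: leq_trans (_ : #|[set u; v] |: [set e in E | e \subset V]| <= _)%N.
      rewrite cardsU1 inE [_ \in E]euv.
      have -> : ([set u; v] \subset V) = false.
        by apply/negbTE; apply: contra vV => /subsetP/(_ v); rewrite !inE eqxx orbT; apply.
      by rewrite /= add0n add1n; apply: leq_trans (leqSpred _) _; rewrite ltnS.
    apply/subset_leq_card/subsetP=> e; rewrite !inE => /orP[/eqP->|/andP[-> eV]] /=.
      by rewrite [_ \in E]euv /=; apply/subsetP=> z; rewrite !inE => /orP[]/eqP->;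
        rewrite ?eqxx ?uV ?orbT.
    exact: subset_trans eV (subsetUr _ _).
  by move/Vmax; rewrite /= cardsU1 vV add1n ltnn.
have := subset_leq_card SV.
have : (#|[set e in E | e \subset V]| <= #|E|)%N.
  by apply/subset_leq_card/subsetP=> e; rewrite inE => /andP[].
lia.
Qed.

Lemma spanning_treeP S E :
  reflect [/\ forall e, e \in E -> #|e| = 2 /\ e \subset S, #|E| = #|S|.-1 &
              {in S &, forall x y, connect (edge_rel E) x y}]
          (spanning_tree S E).
Proof.
apply: (iffP and3P) => [[/subsetP sE /eqP cE /forall_inP con]|[sE cE con]].
  split=> // [e /sE|x y xS yS]; first by rewrite inE => /andP[/eqP].
  by have /forall_inP := con x xS; apply.
split; last 2 first.
- by rewrite cE.
- by apply/forall_inP => x xS; apply/forall_inP => y yS; apply: con.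
by apply/subsetP=> e /sE [ce se]; rewrite inE ce eqxx.
Qed.

(** Otherwise the remaining |S| - 2 edges would still connect S, against [card_connected]. *)
Lemma tree_edge_bridge S E x y :
  spanning_tree S E -> [set x; y] \in E ->
  ~~ connect (edge_rel (E :\ [set x; y])) x y.
Proof.
case/spanning_treeP=> sE cE con exy; apply/negP=> cxy.
have : (#|S|.-1 <= #|E :\ [set x; y]|)%N.
  apply: card_connected => u v uS vS.
  apply: (connect_sub _ (con u v uS vS)) => a b eab.
  have [eq|neq] := eqVneq [set a; b] [set x; y].
    by case: (set2_eq eq) => -[-> ->] //; rewrite connectC.
  by apply: connect1; rewrite /edge_rel !inE neq.
by rewrite -cE (cardsD1 [set x; y] E) exy add1n ltnn.
Qed.

(** Removing the edge leaves two components, that of x (the set A) and that of y; any edge leaving A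
    joins them again. *)
Lemma tree_swap S E x y u v :
  spanning_tree S E -> [set x; y] \in E -> u \in S -> v \in S ->
  let A := [set z | connect (edge_rel (E :\ [set x; y])) x z] in
  u \in A -> v \notin A ->
  [set u; v] \notin E :\ [set x; y] /\
  spanning_tree S ([set u; v] |: (E :\ [set x; y])).
Proof.
move=> tE exy uS vS A uA vA; set E1 := E :\ _; set E2 := [set u; v] |: E1.
have nuv : [set u; v] \notin E1.
  apply: contra vA => euv; move: uA; rewrite !inE => uA.
  exact: connect_trans uA (connect1 euv).
split=> //.
have [sE cE con] := elimT (spanning_treeP _ _) tE.
have [cxy sxy] := sE _ exy.
have xS : x \in S by apply: (subsetP sxy); rewrite !inE eqxx.
have yS : y \in S by apply: (subsetP sxy); rewrite !inE eqxx orbT.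
(* The vertices reachable from x or y in [E1] are left by no edge of E, since the deleted edge has
   both ends among them. *)
have twosides z : z \in S -> connect (edge_rel E1) x z || connect (edge_rel E1) y z.
  move=> zS; apply/negPn/negP=> nz.
  pose B := [set z | connect (edge_rel E1) x z || connect (edge_rel E1) y z].
  have xB : x \in B by rewrite inE connect0.
  have zB : z \notin B by rewrite inE.
  have [a [b [eab]]] := connect_crosses (con x z xS zS) xB zB.
  rewrite !inE => aB /negP; apply.
  have [eq|neq] := eqVneq [set a; b] [set x; y].
    by case: (set2_eq eq) => -[_ ->]; rewrite connect0 ?orbT.
  have e1ab : edge_rel E1 a b by rewrite /edge_rel !inE neq.
  by case/orP: aB => c; rewrite (connect_trans c (connect1 e1ab)) ?orbT.
have sub12 a b : connect (edge_rel E1) a b -> connect (edge_rel E2) a b.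
  apply: connect_sub => c d ecd; apply: connect1.
  by rewrite /edge_rel !inE; move: ecd; rewrite /edge_rel !inE => ->; rewrite orbT.
have uv2 : connect (edge_rel E2) u v by apply: connect1; rewrite /edge_rel setU11.
move: uA vA; rewrite !inE => uA vA.
have yv : connect (edge_rel E1) y v by have := twosides v vS; rewrite (negbTE vA).
have xv : connect (edge_rel E2) x v by apply: connect_trans (sub12 _ _ uA) uv2.
have xy : connect (edge_rel E2) x y.
  by apply: connect_trans xv _; rewrite connectC; apply: sub12.
have xall z : z \in S -> connect (edge_rel E2) x z.
  by move/twosides/orP=> [/sub12//|/sub12]; apply: connect_trans.
apply/spanning_treeP; split.
- move=> e; rewrite !inE => /orP[/eqP->|/andP[_ /sE//]].
  rewrite cards2; have -> : u != v by apply: contraNneq vA => <-.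
  by split=> //; apply/subsetP=> z; rewrite !inE => /orP[]/eqP->.
- by rewrite cardsU1 nuv -cE (cardsD1 [set x; y] E) exy.
- by move=> a b aS bS; apply: connect_trans (xall b bS); rewrite connectC xall.
Qed.

Lemma dist_sym (a b : R * R) : dist a b = dist b a.
Proof. by rewrite /dist; congr Num.sqrt; ring. Qed.

Lemma distxx (a : R * R) : dist a a = 0.
Proof. by rewrite /dist !subrr expr0n /= addr0 sqrtr0. Qed.

Lemma edge_len_set2 x y : x != y -> edge_len p [set x; y] = dist (p x) (p y).
Proof.
move=> xy; rewrite /edge_len.
have s2 (f : I -> R) : \sum_(z in [set x; y]) f z = f x + f y.
  by rewrite big_setU1 ?big_set1 // inE.
rewrite !s2 !distxx (dist_sym (p y)); lra.
Qed.

(** The path from x to y has to leave the component of x in E without the edge; the step where it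
    does so yields the swapped tree, and minimality compares the two lengths. *)
Lemma mst_exchange S E x y s (r : rel I) :
  is_mst p S E -> [set x; y] \in E ->
  path r x s -> last x s = y -> (forall a b, r a b -> (a \in S) && (b \in S)) ->
  exists a b, [/\ r a b, a != b, [set a; b] \notin E :\ [set x; y],
    spanning_tree S ([set a; b] |: (E :\ [set x; y])) &
    dist (p x) (p y) <= dist (p a) (p b)].
Proof.
case/andP=> tE /forall_inP minE exy prs lst rS.
have xy : x != y.
  have [sE _ _] := elimT (spanning_treeP _ _) tE; have [+ _] := sE _ exy.
  by rewrite cards2; case: eqP.
pose A := [set z | connect (edge_rel (E :\ [set x; y])) x z].
have xA : x \in A by rewrite inE connect0.
have yA : last x s \notin A by rewrite lst inE (tree_edge_bridge tE).
have [a [b [rab aA bA]]] := path_crosses prs xA yA.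
have /andP[aS bS] := rS a b rab.
have [nab tab] := tree_swap tE exy aS bS aA bA.
have ab : a != b by apply: contraNneq bA => <-.
exists a, b; split=> //.
have := minE _ tab; rewrite /weight big_setU1 //= (big_setD1 [set x; y]) //=.
by rewrite lerD2r !edge_len_set2.
Qed.

(** The cycle property in the form used below: an edge is excluded by exhibiting a path of strictly
    shorter steps within S. *)
Lemma mst_no_shortcut S E x y s :
  is_mst p S E -> [set x; y] \in E -> last x s = y ->
  path [rel a b | [&& a \in S, b \in S & dist (p a) (p b) < dist (p x) (p y)]] x s ->
  False.
Proof.
move=> mE exy lst prs; have [|a [b [/= + _ _ _]]] := mst_exchange mE exy prs lst.
  by move=> a b /and3P[-> ->].
by case/and3P=> _ _ /lt_geF ->.
Qed.

(** With uniqueness, steps of equal length are allowed too: exchanging the edge for such a step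
    would give a second minimum tree. The gadget of the lower bound needs this, because its two
    candidate jumps may be equally long. *)
Lemma unique_mst_no_shortcut S E x y s :
  is_mst p S E -> (forall E', is_mst p S E' -> E' = E) ->
  [set x; y] \in E -> last x s = y ->
  path [rel a b | [&& a \in S, b \in S, [set a; b] != [set x; y] &
                     dist (p a) (p b) <= dist (p x) (p y)]] x s ->
  False.
Proof.
move=> mE uE exy lst prs.
have [|a [b [/= /and4P[_ _ ne le] ab nab tab _]]] := mst_exchange mE exy prs lst.
  by move=> a b /and4P[-> ->].
have xy : x != y.
  case/andP: mE => /spanning_treeP[sE _ _] _; have [+ _] := sE _ exy.
  by rewrite cards2; case: eqP.
have : is_mst p S ([set a; b] |: (E :\ [set x; y])).
  case/andP: mE => tE /forall_inP minE; rewrite /is_mst tab /=.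
  apply/forall_inP=> E' /minE; apply: le_trans.
  rewrite /weight big_setU1 //= [X in _ <= X](big_setD1 [set x; y]) //=.
  by rewrite lerD2r !edge_len_set2.
move/uE=> eqE; move: exy; rewrite -eqE !inE eqxx /= orbF => /eqP eq.
by rewrite eq eqxx in ne.
Qed.

Lemma mst_edgeP S E e :
  is_mst p S E -> e \in E -> exists x y, [/\ e = [set x; y], x != y, x \in S & y \in S].
Proof.
case/andP=> /spanning_treeP[sE _ _] _ /sE[/eqP/cards2P[x [y [xy ->]]] /subsetP sub].
by exists x, y; split=> //; apply: sub; rewrite !inE eqxx ?orbT.
Qed.

Lemma mst_crosses S E A x y :
  is_mst p S E -> x \in S -> y \in S -> x \in A -> y \notin A ->
  exists u v, [/\ [set u; v] \in E, u \in A & v \notin A].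
Proof.
by case/andP=> /spanning_treeP[_ _ con] _ xS yS; apply: connect_crosses (con x y xS yS).
Qed.

(** The star centred at [x0] is a spanning tree, and only finitely many edge sets compete. *)
Lemma exists_mst S : exists E, is_mst p S E.
Proof.
suff [E0 tE0] : exists E, spanning_tree S E.
  case: (arg_minP (weight p) tE0) => E tE minE; exists E; rewrite /is_mst tE /=.
  exact/forall_inP.
have [->|[x0 x0S]] := set_0Vmem S.
  exists set0; apply/spanning_treeP; split=> [e||x y]; rewrite ?inE ?cards0 //.
exists [set [set x0; y] | y in S :\ x0]; apply/spanning_treeP; split.
- move=> e /imsetP[y]; rewrite !inE => /andP[yx yS] ->; rewrite cards2 eq_sym yx.
  by split=> //; apply/subsetP=> z; rewrite !inE => /orP[]/eqP->.
- rewrite card_in_imset; first by have := cardsD1 x0 S; rewrite x0S => ->.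
  move=> y z; rewrite !inE => /andP[yx _] /andP[zx _] /set2_eq[[]//|[e1 e2]].
  by rewrite e2 eqxx in yx.
have c0 z : z \in S -> connect (edge_rel [set [set x0; y] | y in S :\ x0]) x0 z.
  move=> zS; have [->|zx] := eqVneq z x0; first exact: connect0.
  by apply: connect1; apply/imsetP; exists z; rewrite // !inE zx.
by move=> x y xS yS; apply: connect_trans (c0 y yS); rewrite connectC c0.
Qed.

End EdgeSets.

(** * Segments and convex position *)

Section Orientation.
Variable R : realType.
Implicit Types (a b c d x : R * R).

(** Twice the signed area of the triangle, positive when a, b, c turn counterclockwise; [collinear]
    is its vanishing. *)
Definition orient a b c : R := (b.1 - a.1) * (c.2 - a.2) - (b.2 - a.2) * (c.1 - a.1).

Lemma orient_rot a b c : orient b c a = orient a b c.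
Proof. rewrite /orient; ring. Qed.

(** Along each segment the signed area over the other line is affine and changes sign; its zero is
    the parameter of the common point. *)
Lemma seg_intersect_of_orient a b c d :
  orient a b c < 0 -> 0 < orient a b d -> 0 < orient c d a -> orient c d b < 0 ->
  seg_intersect a b c d.
Proof.
move=> abc abd cda cdb.
exists (orient c d a / (orient c d a - orient c d b)),
  (orient a b c / (orient a b c - orient a b d)).
have n1 : orient c d a - orient c d b != 0 by apply/eqP => h; lra.
have n2 : orient a b c - orient a b d != 0 by apply/eqP => h; lra.
have p1 : 0 < orient c d a - orient c d b by lra.
have p2 : 0 < orient a b d - orient a b c by lra.
split.
- by rewrite ler_pdivlMr // mul0r ler_pdivrMr // mul1r; apply/andP; split; lra.
- have -> : orient a b c / (orient a b c - orient a b d) =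
            (- orient a b c) / (orient a b d - orient a b c).
    by rewrite -(opprB (orient a b c)) invrN mulrNN.
  by rewrite ler_pdivlMr // mul0r ler_pdivrMr // mul1r; apply/andP; split; lra.
- by move: n1 n2; rewrite /orient => n1 n2; field; rewrite n1 n2.
- by move: n1 n2; rewrite /orient => n1 n2; field; rewrite n1 n2.
Qed.

(** The area over a b must vanish at the common point, but there it is a convex combination of two
    nonzero values of the same sign. *)
Lemma seg_intersect_same_side a b c d :
  seg_intersect a b c d -> 0 < orient a b c * orient a b d -> False.
Proof.
case=> s [t [_ /andP[t0 t1] e1 e2]] pos.
have z : (1 - t) * orient a b c + t * orient a b d = 0.
  have -> : (1 - t) * orient a b c + t * orient a b d =
    (b.1 - a.1) * ((c.2 + t * (d.2 - c.2)) - a.2)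
    - (b.2 - a.2) * ((c.1 + t * (d.1 - c.1)) - a.1) by rewrite /orient; ring.
  by rewrite -e1 -e2; ring.
have zc : (1 - t) * (orient a b c * orient a b c) + t * (orient a b c * orient a b d) = 0.
  have -> : (1 - t) * (orient a b c * orient a b c) + t * (orient a b c * orient a b d) =
    orient a b c * ((1 - t) * orient a b c + t * orient a b d) by ring.
  by rewrite z mulr0.
have c2 : 0 <= orient a b c * orient a b c by rewrite -expr2 sqr_ge0.
have nz : orient a b c != 0 by apply: contraTneq pos => ->; rewrite mul0r ltxx.
have c3 : 0 < orient a b c * orient a b c by rewrite -expr2 exprn_even_gt0.
have [t12|t12] := lerP t (1/2).
- have : 0 < (1 - t) * (orient a b c * orient a b c) by rewrite mulr_gt0 //; lra.
  have : 0 <= t * (orient a b c * orient a b d) by rewrite mulr_ge0 // ltW.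
  lra.
- have : 0 <= (1 - t) * (orient a b c * orient a b c) by rewrite mulr_ge0 //; lra.
  have : 0 < t * (orient a b c * orient a b d) by rewrite mulr_gt0 //; lra.
  lra.
Qed.

Lemma seg_intersect_swapl a b c d : seg_intersect a b c d -> seg_intersect b a c d.
Proof.
case=> s [t [/andP[s0 s1] t01 e1 e2]]; exists (1 - s), t; split=> //.
- by apply/andP; split; lra.
- by rewrite -e1; ring.
- by rewrite -e2; ring.
Qed.

Lemma seg_intersectC a b c d : seg_intersect a b c d -> seg_intersect c d a b.
Proof. by case=> s [t [? ? e1 e2]]; exists t, s; split. Qed.

Lemma convex_position_triangle (I : finType) (p : I -> R * R) (x a b c : I) :
  convex_position p -> x != a -> x != b -> x != c ->
  0 < orient (p a) (p b) (p c) -> 0 <= orient (p x) (p b) (p c) ->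
  0 <= orient (p a) (p x) (p c) -> 0 <= orient (p a) (p b) (p x) -> False.
Proof.
move=> cvx xa xb xc D0 la lb lc; apply: (cvx x).
pose D := orient (p a) (p b) (p c).
exists (fun y => (y == a)%:R * (orient (p x) (p b) (p c) / D)
  + (y == b)%:R * (orient (p a) (p x) (p c) / D)
  + (y == c)%:R * (orient (p a) (p b) (p x) / D)).
have delta (z : I) (k : R) (f : I -> R) : \sum_y (y == z)%:R * k * f y = k * f z.
  rewrite (bigD1 z) //= eqxx mul1r big1 ?addr0 // => y /negbTE ->.
  by rewrite !mul0r.
have Dn : D != 0 by rewrite gt_eqF.
have sumE (f : I -> R) : \sum_y ((y == a)%:R * (orient (p x) (p b) (p c) / D)
  + (y == b)%:R * (orient (p a) (p x) (p c) / D)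
  + (y == c)%:R * (orient (p a) (p b) (p x) / D)) * f y =
  (orient (p x) (p b) (p c) * f a + orient (p a) (p x) (p c) * f b
   + orient (p a) (p b) (p x) * f c) / D.
  rewrite (eq_bigr _ (fun y _ => mulrDl _ _ (f y))) big_split /=.
  rewrite (eq_bigr _ (fun y _ => mulrDl _ _ (f y))) big_split /=.
  by rewrite !delta; field.
split.
- move=> y; rewrite !addr_ge0 // mulr_ge0 // ?ler0n // divr_ge0 // ltW //.
- by rewrite (negbTE xa) (negbTE xb) (negbTE xc) !mul0r !addr0.
- have := sumE (fun=> 1); under eq_bigr do rewrite mulr1.
  move=> ->; rewrite !mulr1.
  have -> : orient (p x) (p b) (p c) + orient (p a) (p x) (p c) + orient (p a) (p b) (p x) = D.
    by rewrite /D /orient; ring.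
  by rewrite divff.
- rewrite (sumE (fun y => (p y).1)); apply: (mulIf Dn); rewrite divfK //.
  by rewrite /D /orient; ring.
- rewrite (sumE (fun y => (p y).2)); apply: (mulIf Dn); rewrite divfK //.
  by rewrite /D /orient; ring.
Qed.

End Orientation.

(** * Grid indices, boundary order and alternating chords *)

Section GridPoints.
Variable M : nat.
Local Notation I := ('I_M.+1 + 'I_M.+1)%type.
Implicit Types (x y z : I) (a b : bool).

Definition col x : nat := match x with inl i => i | inr i => i end.
Definition row x : bool := if x is inr _ then true else false.
(** [inord] sends a number above M to column 0, hence the side conditions k <= M in what follows. *)
Definition gpt a (k : nat) : I := if a then inr (inord k) else inl (inord k).

(* Counterclockwise numbering of the boundary, starting at the lower left corner. *)
Definition pos x : nat := if row x then (M.*2.+1 - col x)%N else col x.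

Lemma col_le x : (col x <= M)%N.
Proof. by case: x => i; rewrite -ltnS ltn_ord. Qed.

Lemma col_gpt a k : (k <= M)%N -> col (gpt a k) = k.
Proof. by move=> kM; case: a; rewrite /= inordK. Qed.

Lemma row_gpt a k : row (gpt a k) = a.
Proof. by case: a. Qed.

Lemma gptK x : gpt (row x) (col x) = x.
Proof. by case: x => i; rewrite /gpt /= inord_val. Qed.

Lemma gpt_inj a b k l : (k <= M)%N -> (l <= M)%N -> gpt a k = gpt b l -> a = b /\ k = l.
Proof.
move=> kM lM e; split; first by rewrite -(row_gpt a k) e row_gpt.
by rewrite -(col_gpt a kM) e col_gpt.
Qed.

Lemma gpt_eq a b k l : (k <= M)%N -> (l <= M)%N -> (gpt a k == gpt b l) = (a == b) && (k == l).
Proof.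
move=> kM lM; apply/eqP/andP => [/gpt_inj[]// -> ->|[/eqP-> /eqP->]//].
by rewrite !eqxx.
Qed.

Lemma pos_gpt a k : (k <= M)%N -> pos (gpt a k) = if a then (M.*2.+1 - k)%N else k.
Proof. by move=> kM; rewrite /pos row_gpt col_gpt. Qed.

Lemma pos_inj : injective pos.
Proof.
move=> x y e; rewrite -(gptK x) -(gptK y); move: e (col_le x) (col_le y).
rewrite /pos; case: (row x); case: (row y) => e hx hy; congr gpt; lia.
Qed.

Definition separates x y z := ((pos x < pos z < pos y) || (pos y < pos z < pos x))%N.
Definition alternate x y z t := separates x y z != separates x y t.

Variable R : realType.
Variable p : I -> R * R.

Definition ccw := forall x y z, (pos x < pos y < pos z)%N -> 0 < orient (p x) (p y) (p z).

(** Each ordering of the three points is a rotation or a reflection of the increasing one, and only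
    a reflection flips the sign. *)
Lemma ccw_orient_sign x y z : ccw -> x != y -> y != z -> x != z ->
  if separates x y z == (pos y < pos x)%N then 0 < orient (p x) (p y) (p z)
  else orient (p x) (p y) (p z) < 0.
Proof.
move=> hccw; rewrite -!(inj_eq pos_inj) => xy yz xz; rewrite /separates.
set o := orient (p x) (p y) (p z).
have e1 : orient (p y) (p z) (p x) = o by rewrite /o /orient; ring.
have e2 : orient (p z) (p x) (p y) = o by rewrite /o /orient; ring.
have e3 : orient (p y) (p x) (p z) = - o by rewrite /o /orient; ring.
have e4 : orient (p x) (p z) (p y) = - o by rewrite /o /orient; ring.
have e5 : orient (p z) (p y) (p x) = - o by rewrite /o /orient; ring.
have := (hccw x y z, hccw y z x, hccw z x y, hccw y x z, hccw x z y, hccw z y x).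
rewrite e1 e2 e3 e4 e5 -/o oppr_gt0.
move: xy yz xz; case: (ltngtP (pos x) (pos y)) => //; case: (ltngtP (pos y) (pos z)) => //;
  case: (ltngtP (pos x) (pos z)) => //= h1 h2 h3 _ _ _; try lia;
  by case=> -[[[[]]]] => k1 k2 k3 k4 k5 k6; auto.
Qed.

Lemma seg_intersect_alternate x y z t : ccw -> uniq [:: x; y; z; t] ->
  seg_intersect (p x) (p y) (p z) (p t) -> alternate x y z t.
Proof.
move=> hccw /=; rewrite !inE !negb_or !andbT => /and3P[/and3P[xy xz xt] /andP[yz yt] zt].
move=> hs; apply/negP => /eqP alt; apply: (seg_intersect_same_side hs).
have := ccw_orient_sign hccw xy yt xt; have := ccw_orient_sign hccw xy yz xz.
rewrite -alt; case: ifP => _ h1 h2; first exact: mulr_gt0.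
by rewrite nmulr_rgt0.
Qed.

Lemma alternate_seg_intersect x y z t : ccw -> uniq [:: x; y; z; t] ->
  alternate x y z t -> seg_intersect (p x) (p y) (p z) (p t).
Proof.
move=> hccw /=; rewrite !inE !negb_or !andbT => /and3P[/and3P[xy xz xt] /andP[yz yt] zt] alt.
(* Exchanging z and t if needed, z lies to the right of the line from x to y, and t to its left. *)
wlog s1 : z t xz xt yz yt zt alt / separates x y z == (pos x < pos y)%N.
  move=> wl; have [e|ne] := eqVneq (separates x y z) (pos x < pos y)%N.
    by apply: wl; rewrite ?e.
  apply/seg_intersectC/seg_intersect_swapl/seg_intersectC.
  apply: wl => //; [by rewrite eq_sym | by rewrite /alternate eq_sym | ].
  by move: alt ne; rewrite /alternate; case: separates; case: separates; case: (_ < _)%N.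
have s2 : separates x y t == (pos y < pos x)%N.
  move: alt s1; rewrite /alternate; move: xy; rewrite -(inj_eq pos_inj).
  by case: ltngtP => //= _ _; do 2 case: separates.
have s3 : (separates z t x == (pos t < pos z)%N) && (separates z t y != (pos t < pos z)%N).
  move: s1 s2 xy xz xt yz yt zt; rewrite -!(inj_eq pos_inj) /separates; clear.
  case: (ltngtP (pos x) (pos y)) => // ?; rewrite /= ?andbF ?andbT ?orbF ?orbT /= => *.
  - lia.
  - lia.
case/andP: s3 => s3 s4.
have := ccw_orient_sign hccw xy yt xt; have := ccw_orient_sign hccw xy yz xz.
rewrite s2 => + od; have -> : (separates x y z == (pos y < pos x)%N) = false.
  move: xy s1; rewrite -(inj_eq pos_inj); case: ltngtP => //= _ _; by case: separates.
move=> oc.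
have := ccw_orient_sign hccw zt _ _; move=> /(_ x); rewrite s3 ![t == _]eq_sym ![z == _]eq_sym.
move=> /(_ xt xz) oa.
have := ccw_orient_sign hccw zt; move=> /(_ y); rewrite (negbTE s4) ![t == _]eq_sym ![z == _]eq_sym.
move=> /(_ yt yz) ob.
exact: seg_intersect_of_orient.
Qed.

End GridPoints.

(** * Spanning trees near the grid *)

Section NearGrid.
Variables (R : realType) (M : nat).
Local Notation I := ('I_M.+1 + 'I_M.+1)%type.
Variables (p : I -> R * R) (eps : R).
Implicit Types (x y z t : I) (a b : bool) (S : {set I}) (E : {set {set I}}).

Definition close := forall x,
  `|(p x).1 - (col x).+1%:R| <= eps /\ `|(p x).2 - (row x)%:R| <= eps.

Hypothesis eps_small : eps * M.+1%:R <= 1 / 100.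
Hypothesis pclose : close.

Definition sqd (a b : R * R) : R := (a.1 - b.1) ^+ 2 + (a.2 - b.2) ^+ 2.

(** Squared distance of the unperturbed grid points; subtraction is truncated, so one of the two
    column squares is zero. *)
Definition gsqd x y : nat :=
  ((col x - col y) ^ 2 + (col y - col x) ^ 2 + (row x != row y))%N.

Lemma gsqdE x y : (gsqd x y)%:R =
  ((col x)%:R - (col y)%:R) ^+ 2 + ((row x)%:R - (row y)%:R) ^+ 2 :> R.
Proof.
rewrite /gsqd !natrD !natrX; congr (_ + _).
  have [h|/ltnW h] := leqP (col x) (col y); rewrite (natrB _ h).
    by have -> : (col x - col y = 0)%N by [lia]; rewrite expr0n add0r -sqrrN opprB.
  by have -> : (col y - col x = 0)%N by [lia]; rewrite expr0n addr0.
by case: (row x); case: (row y); rewrite ?subrr ?subr0 ?sub0r ?sqrrN ?expr0n ?expr1n.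
Qed.

Lemma eps_ge0 : 0 <= eps.
Proof. by have [h _] := pclose (gpt M false 0); apply: le_trans h. Qed.

Lemma eps_le : eps <= 1 / 100.
Proof.
apply: le_trans eps_small; rewrite ler_peMr ?eps_ge0 //.
by rewrite ler1n.
Qed.

Lemma col_leR x : (0 <= (col x)%:R :> R) && ((col x)%:R <= M%:R :> R).
Proof. by rewrite ler0n ler_nat col_le. Qed.

Lemma epsM : eps * M%:R <= 1 / 100.
Proof.
by apply: le_trans eps_small; rewrite ler_wpM2l ?eps_ge0 // ler_nat.
Qed.

(** The change is at most 2 eps (2 (M + 1) + 2 eps), which is why [eps_small] involves the width of
    the grid. *)
Lemma sq_perturb (c u : R) : `|c| <= M.+1%:R -> `|u - c| <= 2 * eps ->
  `|u ^+ 2 - c ^+ 2| <= 1 / 20.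
Proof.
move=> hc hu; have -> : u ^+ 2 - c ^+ 2 = (u - c) * (2 * c + (u - c)) by ring.
rewrite normrM.
have h1 : `|2 * c + (u - c)| <= 2 * M.+1%:R + 2 * eps.
  by rewrite (le_trans (ler_normD _ _)) // normrM ger0_norm ?ler0n // lerD // ler_wpM2l.
apply: (le_trans (ler_pM _ _ hu h1)); rewrite ?normr_ge0 //.
have -> : 2 * eps * (2 * M.+1%:R + 2 * eps) = 4 * (eps * M.+1%:R) + 4 * (eps * eps) by ring.
have : eps * eps <= 1 / 100 * (1 / 100) by rewrite ler_pM ?eps_ge0 ?eps_le.
have := eps_small; lra.
Qed.

Lemma sqd_close x y : `|sqd (p x) (p y) - (gsqd x y)%:R| < 1 / 4.
Proof.
rewrite gsqdE /sqd.
have [/andP[x0 x1] /andP[y0 y1]] := (col_leR x, col_leR y).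
have [hx1 hx2] := pclose x; have [hy1 hy2] := pclose y.
have hM : M.+1%:R = M%:R + 1 :> R by rewrite -natr1.
have h1 : `|((p x).1 - (p y).1) ^+ 2 - ((col x)%:R - (col y)%:R) ^+ 2| <= 1 / 20.
  apply: sq_perturb; first by rewrite hM ler_norml; apply/andP; split; lra.
  move: hx1 hy1; rewrite -!natr1 !ler_norml => /andP[? ?] /andP[? ?].
  by apply/andP; split; lra.
have h2 : `|((p x).2 - (p y).2) ^+ 2 - ((row x)%:R - (row y)%:R) ^+ 2| <= 1 / 20.
  apply: sq_perturb.
    rewrite hM; case: (row x); case: (row y);
      rewrite ?subrr ?subr0 ?sub0r ?normrN ?normr1 ?normr0; have := ler0n R M; lra.
  move: hx2 hy2; rewrite !ler_norml => /andP[? ?] /andP[? ?].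
  by apply/andP; split; lra.
move: h1 h2; rewrite !ler_norml ltr_norml => /andP[? ?] /andP[? ?].
by apply/andP; split; lra.
Qed.

Lemma sqd_ge0 (a b : R * R) : 0 <= sqd a b.
Proof. by rewrite addr_ge0 ?sqr_ge0. Qed.

Lemma dist_lt_sqd (a b c d : R * R) : sqd a b < sqd c d -> dist a b < dist c d.
Proof. by move=> h; rewrite /dist ltr_sqrt //; apply: le_lt_trans (sqd_ge0 a b) h. Qed.

(** Squared grid distances are integers and each moves by less than 1/4, so a strict inequality on
    the grid survives the perturbation. *)
Lemma dist_lt_gsqd x y z t : (gsqd x y < gsqd z t)%N ->
  dist (p x) (p y) < dist (p z) (p t).
Proof.
rewrite -(ler_nat R) -natr1 => h; apply: dist_lt_sqd.
have := sqd_close x y; have := sqd_close z t; rewrite !ltr_norml => /andP[? ?] /andP[? ?].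
lra.
Qed.

(** The main term is about a column gap of at least 1 times the height 1; the other product is at
    most 2 eps (M + 2 eps). Proximity to the grid thus orients triples that meet both rows, and
    convexity decides those within one row. *)
Lemma close_orient_ffT x y z : row x = false -> row y = false -> row z = true ->
  (col x < col y)%N -> 0 < orient (p x) (p y) (p z).
Proof.
move=> rx ry rz xy; rewrite /orient.
have [hx1 hx2] := pclose x; have [hy1 hy2] := pclose y; have [hz1 hz2] := pclose z.
have [/andP[x0 x1] /andP[z0 z1]] := (col_leR x, col_leR z).
move: hx2 hy2 hz2 hx1 hy1 hz1; rewrite rx ry rz -!natr1 !subr0 !ler_norml.
move=> /andP[? ?] /andP[? ?] /andP[? ?] /andP[? ?] /andP[? ?] /andP[? ?].
have xyR : (col x)%:R + 1 <= (col y)%:R :> R by rewrite natr1 ler_nat.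
have := eps_le; have := eps_ge0; have := epsM => e1 e2 e3.
have h1 : 98 / 100 * (98 / 100) <= ((p y).1 - (p x).1) * ((p z).2 - (p x).2).
  by apply: ler_pM; lra.
have h2 : `|((p y).2 - (p x).2) * ((p z).1 - (p x).1)| <= 2 * eps * (M%:R + 2 * eps).
  by rewrite normrM ler_pM // ler_norml; apply/andP; split; lra.
have h3 : eps * eps <= 1 / 100 * (1 / 100) by rewrite ler_pM.
move: h2; rewrite ler_norml => /andP[_ h2]; lra.
Qed.

Lemma close_orient_fTT x y z : row x = false -> row y = true -> row z = true ->
  (col z < col y)%N -> 0 < orient (p x) (p y) (p z).
Proof.
move=> rx ry rz zy.
have -> : orient (p x) (p y) (p z) = ((p y).1 - (p z).1) * ((p z).2 - (p x).2)
   - ((p z).2 - (p y).2) * ((p x).1 - (p z).1) by rewrite /orient; ring.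
have [hx1 hx2] := pclose x; have [hy1 hy2] := pclose y; have [hz1 hz2] := pclose z.
have [/andP[x0 x1] /andP[z0 z1]] := (col_leR x, col_leR z).
move: hx2 hy2 hz2 hx1 hy1 hz1; rewrite rx ry rz -!natr1 !subr0 !ler_norml.
move=> /andP[? ?] /andP[? ?] /andP[? ?] /andP[? ?] /andP[? ?] /andP[? ?].
have zyR : (col z)%:R + 1 <= (col y)%:R :> R by rewrite natr1 ler_nat.
have := eps_le; have := eps_ge0; have := epsM => e1 e2 e3.
have h1 : 98 / 100 * (98 / 100) <= ((p y).1 - (p z).1) * ((p z).2 - (p x).2).
  by apply: ler_pM; lra.
have h2 : `|((p z).2 - (p y).2) * ((p x).1 - (p z).1)| <= 2 * eps * (M%:R + 2 * eps).
  by rewrite normrM ler_pM // ler_norml; apply/andP; split; lra.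
have h3 : eps * eps <= 1 / 100 * (1 / 100) by rewrite ler_pM.
move: h2; rewrite ler_norml => /andP[_ h2]; lra.
Qed.

Lemma ccw_of_rows :
  (forall x y z, row x = false -> row y = false -> row z = false ->
     (col x < col y < col z)%N -> 0 < orient (p x) (p y) (p z)) ->
  (forall x y z, row x = true -> row y = true -> row z = true ->
     (col z < col y < col x)%N -> 0 < orient (p x) (p y) (p z)) ->
  ccw p.
Proof.
move=> hv hw x y z; have [cx [cy cz]] := (col_le x, (col_le y, col_le z)).
rewrite /pos; case rx: (row x); case ry: (row y); case rz: (row z) => // /andP[h1 h2].
all: try by lia.
- by apply: hw => //; lia.
- by apply: close_orient_fTT => //; lia.
- exact: close_orient_ffT.
- by apply: hv => //; lia.
Qed.

(** If the middle one of three points in a row turned the wrong way, it would lie in the triangle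
    spanned by the two others and the opposite point of its own column. *)
Lemma convex_ccw : convex_position p -> ccw p.
Proof.
move=> cvx; apply: ccw_of_rows => x y z rx ry rz /andP[h1 h2]; rewrite ltNge; apply/negP => le0.
- have [rw cw] := (row_gpt M true (col y), col_gpt true (col_le y)).
  have ne u : row u = false -> col y != col u -> (y != u) by move=> _; apply: contraNneq => ->.
  apply: (@convex_position_triangle _ _ p y x z (gpt M true (col y)) cvx).
  + by apply: ne => //; lia.
  + by apply: ne => //; lia.
  + by apply/eqP => e; move: rw; rewrite -e ry.
  + by apply: close_orient_ffT => //; lia.
  + by apply/ltW/close_orient_ffT.
  + by apply/ltW/close_orient_ffT.
  + have -> : orient (p x) (p z) (p y) = - orient (p x) (p y) (p z) by rewrite /orient; ring.
    by rewrite oppr_ge0.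
- have [rw cw] := (row_gpt M false (col y), col_gpt false (col_le y)).
  have ne u : row u = true -> col y != col u -> (y != u) by move=> _; apply: contraNneq => ->.
  apply: (@convex_position_triangle _ _ p y x z (gpt M false (col y)) cvx).
  + by apply: ne => //; lia.
  + by apply: ne => //; lia.
  + by apply/eqP => e; move: rw; rewrite -e ry.
  + by rewrite -2!orient_rot; apply: close_orient_fTT => //; lia.
  + by rewrite -2!orient_rot; apply/ltW/close_orient_fTT.
  + by rewrite -2!orient_rot; apply/ltW/close_orient_fTT.
  + have -> : orient (p x) (p z) (p y) = - orient (p x) (p y) (p z) by rewrite /orient; ring.
    by rewrite oppr_ge0.
Qed.

(** With column gaps d1 and d2, z is nearer to either end than these are to each other, even over
    slanted edges: d1^2 + 1 < (d1 + d2)^2, and likewise for d2. *)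
Lemma mst_consecutive S E x y z : is_mst p S E -> [set x; y] \in E ->
  x \in S -> y \in S -> z \in S -> (col x < col z < col y)%N -> False.
Proof.
move=> mE exy xS yS zS /andP[h1 h2].
apply: (@mst_no_shortcut _ _ p S E x y [:: z; y] mE exy) => //=.
have [d1 [d2 [d1p d2p]]] : exists d1 d2, [/\ 0 < d1, 0 < d2, col z = col x + d1 & col y = col x + d1 + d2]%N.
  by exists (col z - col x)%N, (col y - col z)%N; split; lia.
move=> ez ey; rewrite xS yS zS /= andbT.
by apply/andP; split; apply: dist_lt_gsqd; rewrite /gsqd ez ey;
  case: eqP => _; case: eqP => _ /=; clear -d1p d2p; rewrite -!mulnn; nia.
Qed.

(** Another corner of the rectangle, if in S, forms a right-angled triangle with the slanted edge as
    hypotenuse, and the legs give a shortcut. *)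
Lemma mst_diagonal S E a i b j : is_mst p S E -> [set gpt M a i; gpt M b j] \in E ->
  (i < j <= M)%N -> a != b -> gpt M a i \in S -> gpt M b j \in S ->
  (gpt M b i \notin S) && (gpt M a j \notin S).
Proof.
move=> mE exy /andP[ij jM] ab xS yS; have iM : (i <= M)%N by lia.
have key z : z = gpt M b i \/ z = gpt M a j -> z \in S -> False.
  move=> ez zS; apply: (@mst_no_shortcut _ _ p S E _ _ [:: z; gpt M b j] mE exy) => //=.
  rewrite xS yS zS /= andbT; case: ez => ->; apply/andP; split; apply: dist_lt_gsqd;
  rewrite /gsqd !col_gpt // !row_gpt ab ?eqxx ?subnn /= -!mulnn; nia.
by apply/andP; split; apply/negP; apply: key; [left|right].
Qed.

(** The shape of a tree edge over the vertex set given by the predicate s: consecutive nonempty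
    columns, slanted only between two singleton columns. A vertical edge is listed upwards, so that
    its description is unique. *)
Definition good (s : bool -> nat -> bool) a i b j := [/\ (i <= j)%N, s a i /\ s b j,
  forall c k, (i < k < j)%N -> ~~ s c k,
  (i < j)%N -> a != b -> ~~ s b i /\ ~~ s a j & i = j -> a = false /\ b = true].

Lemma mst_good S E e : is_mst p S E -> e \in E -> exists a i b j,
  [/\ e = [set gpt M a i; gpt M b j], (j <= M)%N & good (fun a i => gpt M a i \in S) a i b j].
Proof.
move=> mE eE; have [x [y [ee cxy xy xS yS]]] : exists x y, [/\ e = [set x; y],
    (col x <= col y)%N && ((col x == col y) ==> ~~ row x && row y), x != y, x \in S & y \in S].
  have [x [y [ee xy xS yS]]] := mst_edgeP mE eE.
  have nn : (row x, col x) != (row y, col y).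
    by apply: contraNneq xy => -[r c]; rewrite -(gptK x) r c gptK.
  case h: ((col x <= col y)%N && ((col x == col y) ==> ~~ row x && row y)); first by exists x, y.
  exists y, x; split=> //; [by rewrite ee setUC | | by rewrite eq_sym].
  move: nn h; rewrite xpair_eqE; case: (row x); case: (row y) => /=; lia.
move: eE; rewrite ee => eE; case/andP: cxy => cxy /implyP rxy.
exists (row x), (col x), (row y), (col y); rewrite !gptK col_le; split=> //; split.
- exact: cxy.
- by rewrite !gptK.
- move=> c k /andP[k1 k2]; have kM : (k <= M)%N by have := col_le y; lia.
  apply/negP => zS; apply: (mst_consecutive mE eE xS yS zS).
  by rewrite col_gpt // k1 k2.
- move=> c r; apply/andP; apply: (@mst_diagonal S E (row x) (col x) (row y) (col y)) => //;
    by rewrite ?gptK // c col_le.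
- by move/eqP/rxy/andP=> [/negbTE-> ->].
Qed.
End NearGrid.

(** * Lower bound *)

Section CrossingCounts.
Variables (R : realType) (M : nat).
Local Notation I := ('I_M.+1 + 'I_M.+1)%type.
Variable p : I -> R * R.
Implicit Types (e f : {set I}) (E : bool -> {set {set I}}) (c : bool).

Lemma edges_crossC e f : edges_cross p e f -> edges_cross p f e.
Proof.
case=> [x [y [z [t [-> -> h]]]]]; exists z, t, x, y; split=> //; exact: seg_intersectC.
Qed.

Lemma edges_crossP x y z t : ccw p -> uniq [:: x; y; z; t] ->
  edges_cross p [set x; y] [set z; t] <-> alternate x y z t.
Proof.
move=> hccw un; split; last first.
  by move=> alt; exists x, y, z, t; split=> //; apply: alternate_seg_intersect.
case=> [x' [y' [z' [t' [/esym exy /esym ezt h]]]]]; apply: (seg_intersect_alternate hccw un).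
case: (set2_eq exy) => -[ex ey]; case: (set2_eq ezt) => -[ez et]; subst=> //.
- by apply/seg_intersectC/seg_intersect_swapl/seg_intersectC.
- by apply/seg_intersect_swapl.
- by apply/seg_intersectC/seg_intersect_swapl/seg_intersectC/seg_intersect_swapl.
Qed.

Definition rcol e : nat := \max_(x in e) col x.
Definition sumcol e : nat := (\sum_(x in e) col x)%N.

Lemma rcol_set2 x y : rcol [set x; y] = maxn (col x) (col y).
Proof.
rewrite /rcol; have [->|xy] := eqVneq x y; first by rewrite setUid big_set1 maxnn.
by rewrite big_setU1 ?big_set1 // inE.
Qed.

Lemma sumcol_set2 x y : x != y -> sumcol [set x; y] = (col x + col y)%N.
Proof. by move=> xy; rewrite /sumcol big_setU1 ?big_set1 // inE. Qed.

Definition crossing_pairs E : {set {set I} * {set I}} :=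
  [set ef | [&& ef.1 \in E true, ef.2 \in E false & `[< edges_cross p ef.1 ef.2 >]]].

(** The columns are swept from left to right; a crossing is counted once the right ends of both
    edges are reached. *)
Definition crossings_upto E k := [set ef in crossing_pairs E | (rcol ef.1 <= k) && (rcol ef.2 <= k)]%N.

Lemma rcol_le e : (rcol e <= M)%N.
Proof. by apply/bigmax_leqP => x _; apply: col_le. Qed.

Lemma crossings_upto_all E : #|crossings_upto E M| = crossings p (E true) (E false).
Proof.
rewrite /crossings; apply: eq_card => ef; by rewrite !inE !rcol_le /= andbT.
Qed.

Definition colour_order c (ef : {set I} * {set I}) := if c then ef else (ef.2, ef.1).

Lemma colour_order_inj c : injective (colour_order c).
Proof. by case: c => -[a b] [a' b'] // [-> ->]. Qed.

Lemma mem_crossings_upto E c e f k : e \in E c -> f \in E (~~ c) -> edges_cross p e f ->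
  (colour_order c (e, f) \in crossings_upto E k) = (rcol e <= k)%N && (rcol f <= k)%N.
Proof.
case: c => /= eE fE ef; rewrite !inE /= eE fE /=.
  by rewrite (introT (asboolP _) ef).
by rewrite (introT (asboolP _) (edges_crossC ef)) /= andbC.
Qed.

(** Each listed pair has a right end beyond k, so none of them was counted before. *)
Lemma crossings_upto_add E k l (s : seq ({set I} * {set I})) :
  (k <= l)%N -> uniq s -> all (fun ef => ef \in crossings_upto E l) s ->
  all (fun ef => (k < rcol ef.1) || (k < rcol ef.2))%N s ->
  (#|crossings_upto E k| + size s <= #|crossings_upto E l|)%N.
Proof.
move=> kl us /allP sl /allP sk.
have dis : [disjoint crossings_upto E k & s].
  rewrite disjoint_sym disjoint_subset; apply/subsetP=> ef /sk; rewrite !inE.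
  by rewrite !ltnNge -negb_and => /negbTE ->; rewrite andbF.
have /card_uniqP <- := us; rewrite -(cardUI _ (mem s)).
move: dis; rewrite disjoint_subset => /subsetP dis.
rewrite [X in (_ + X)%N]eq_card0 ?addn0; last first.
  by move=> ef; apply/negP => /andP[h es]; move: (dis _ h); rewrite inE /= => /negP; apply.
apply/subset_leq_card/subsetP=> ef; rewrite inE => /orP[|/sl//].
rewrite !inE => /andP[-> /andP[h1 h2]] /=.
by rewrite (leq_trans h1 kl) (leq_trans h2 kl).
Qed.

Lemma cr_ge S ER EB : is_mst p S ER -> is_mst p (~: S) EB ->
  (crossings p ER EB <= cr p)%N.
Proof.
move=> mR mB; rewrite /cr (leq_trans _ (leq_bigmax S)) // /cr_RB.
apply: (leq_trans _ (leq_bigmax_cond _ (_ : ER \in _))); last by rewrite inE.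
by apply: (leq_trans _ (leq_bigmax_cond _ (_ : EB \in _))); last by rewrite inE.
Qed.

Lemma cr_le n : (forall S ER EB, is_mst p S ER -> is_mst p (~: S) EB ->
  crossings p ER EB <= n)%N -> (cr p <= n)%N.
Proof.
move=> h; apply/bigmax_leqP=> S _; apply/bigmax_leqP=> ER; rewrite inE => mR.
by apply/bigmax_leqP=> EB; rewrite inE => mB; apply: h mR mB.
Qed.

End CrossingCounts.

(** * Edges forced by cuts of the spanning tree *)

Section MstEdges.
Variables (R : realType) (M : nat).
Local Notation I := ('I_M.+1 + 'I_M.+1)%type.
Variables (p : I -> R * R) (eps : R).
Hypothesis eps_small : eps * M.+1%:R <= 1 / 100.
Hypothesis pclose : close p eps.
Implicit Types (S : {set I}) (E : {set {set I}}).

Lemma mst_good_pair S E a i b j : is_mst p S E -> (i < j <= M)%N ->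
  [set gpt M a i; gpt M b j] \in E -> good (fun a i => gpt M a i \in S) a i b j.
Proof.
move=> mE /andP[ij jM] eE; have [a' [i' [b' [j' [ee j'M g]]]]] := mst_good eps_small pclose mE eE.
clear eps_small pclose mE.
have [i'j' _ _ _ _] := g.
have iM : (i <= M)%N by lia.
have i'M : (i' <= M)%N by lia.
case: (set2_eq ee) => -[/gpt_inj h1 /gpt_inj h2].
  by case: h1 => // -> ->; case: h2 => // -> ->.
by case: h1 => // _ h1; case: h2 => // _ h2; lia.
Qed.

(** Cut behind column i: the tree edge across this cut has no vertex in a column strictly between
    its ends, so its ends lie in columns i and j themselves. *)
Lemma mst_gap_edge S E i j a b : is_mst p S E -> (i < j <= M)%N ->
  gpt M a i \in S -> gpt M b j \in S ->
  (forall c k, (i < k < j)%N -> gpt M c k \notin S) ->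
  exists a' b', [set gpt M a' i; gpt M b' j] \in E.
Proof.
move=> mE /andP[ij jM] aS bS gap; have iM : (i <= M)%N by lia.
pose A : {set I} := [set x | (col x <= i)%N].
have aA : gpt M a i \in A by rewrite inE col_gpt.
have bA : gpt M b j \notin A by rewrite inE col_gpt // -ltnNge.
have [u [v [uvE uA vA]]] := mst_crosses mE aS bS aA bA.
have [a' [i' [b' [j' [ee j'M [i'j' [a'S b'S] emp _ _]]]]]] := mst_good eps_small pclose mE uvE.
clear eps_small pclose mE.
have i'M : (i' <= M)%N := leq_trans i'j' j'M.
have [i'i ij'] : (i' <= i /\ i < j')%N.
  move: uA vA; rewrite !inE -ltnNge.
  case: (set2_eq ee) => -[-> ->]; rewrite !col_gpt // => h1 h2; split=> //; lia.
have ei : i' = i.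
  apply/eqP; rewrite eqn_leq i'i leqNgt; apply/negP=> lt.
  by have := emp a i; rewrite lt ij' aS => /(_ isT).
have ej : j' = j.
  apply/eqP; rewrite eqn_leq; apply/andP; split; rewrite leqNgt; apply/negP=> lt.
    by have := emp b j; rewrite lt (leq_ltn_trans i'i ij) bS => /(_ isT).
  by have := gap b' j'; rewrite lt ij' b'S => /(_ isT).
by exists a', b'; move: uvE; rewrite ee ei ej.
Qed.

(* The cut consists of the single point in row a of column i, together with
   all columns to its left when l is set. *)
Lemma mst_vertical_edge S E i a l : is_mst p S E -> (i <= M)%N ->
  gpt M false i \in S -> gpt M true i \in S ->
  (forall c j, (i < j <= M)%N -> [set gpt M a i; gpt M c j] \notin E) ->
  (forall c j, (j < i)%N -> [set gpt M c j; gpt M (a (+) l) i] \notin E) ->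
  [set gpt M false i; gpt M true i] \in E.
Proof.
move=> mE iM vS wS right left.
have aS b : gpt M b i \in S by case: b.
pose A : {set I} := [set x | (l && (col x < i)%N) || (x == gpt M a i)].
have aA : gpt M a i \in A by rewrite inE eqxx orbT.
have bA : gpt M (~~ a) i \notin A.
  by rewrite inE col_gpt // ltnn andbF gpt_eq //; case: (a).
have [u [v [uvE uA vA]]] := mst_crosses mE (aS _) (aS _) aA bA.
have [a' [i' [b' [j' [ee j'M [i'j' [a'S b'S] emp _ vert]]]]]] := mst_good eps_small pclose mE uvE.
clear eps_small pclose mE.
have i'M : (i' <= M)%N := leq_trans i'j' j'M.
have xA : (gpt M a' i' \in A) != (gpt M b' j' \in A).
  by case: (set2_eq ee) => -[<- <-]; rewrite uA (negbTE vA).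
move: xA uvE; rewrite ee !inE !col_gpt // !gpt_eq //.
have [lt|lt|eq] := ltngtP i' j'; last 1 first.
- case: (vert eq) => -> ->; rewrite eq; case: (ltngtP j' i) => [_|_|->] //; by rewrite !andbF eqxx.
- case: (ltngtP i' i) => [i1|i1|ei].
  + case: (ltngtP j' i) => [j1|j1|ej].
    * by rewrite !andbF eqxx.
    * by have := emp false i; rewrite i1 j1 vS => /(_ isT).
    * rewrite !andbF !andbT orbF ej => h eE.
      have := left a' i' i1; suff -> : a (+) l = b' by rewrite eE.
      by move: h; clear; case: (a); case: (b'); case: (l).
  + have j1 := ltn_trans i1 lt.
    by rewrite (gtn_eqF j1) [(j' < i)%N]ltnNge (ltnW j1) !andbF.
  + have j1 : (i < j')%N by rewrite -ei.
    rewrite (gtn_eqF j1) [(j' < i)%N]ltnNge (ltnW j1) ei !andbF andbT => h eE.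
    have := right b' j'; rewrite j1 j'M => /(_ isT).
    suff -> : a = a' by rewrite eE.
    by move: h; clear; case: (a); case: (a').
- by move: i'j'; rewrite leqNgt lt.
Qed.

End MstEdges.

Arguments gpt : simpl never.

Lemma set2_gpt_neq M a b c d i j k l :
  (i <= M)%N -> (j <= M)%N -> (k <= M)%N -> (l <= M)%N ->
  ~~ [|| [&& a == c, i == k, b == d & j == l] | [&& a == d, i == l, b == c & j == k]] ->
  [set gpt M a i; gpt M b j] != [set gpt M c k; gpt M d l].
Proof.
move=> iM jM kM lM; apply: contra => /eqP/set2_eq[] [/gpt_inj [//|//|-> ->] /gpt_inj [//|//|-> ->]];
  by rewrite !eqxx ?orbT.
Qed.

(** * Crossings in a gadget and in the tail of two-coloured columns *)

Section Gadget.
Variables (R : realType) (M : nat).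
Local Notation I := ('I_M.+1 + 'I_M.+1)%type.
Variables (p : I -> R * R) (eps : R).
Hypothesis eps_small : eps * M.+1%:R <= 1 / 100.
Hypothesis pclose : close p eps.
Hypothesis pccw : ccw p.
Variables (s : bool -> nat -> bool) (E : bool -> {set {set I}}).
Definition colour_class c : {set I} := [set x | s (row x) (col x) == c].
Hypothesis Emst : forall c, is_mst p (colour_class c) (E c).

Lemma mem_colour_class c a i : (i <= M)%N -> (gpt M a i \in colour_class c) = (s a i == c).
Proof. by move=> iM; rewrite inE row_gpt col_gpt. Qed.

Lemma good_colour c a i b j : (i < j <= M)%N -> [set gpt M a i; gpt M b j] \in E c ->
  good (fun a i => s a i == c) a i b j.
Proof.
move=> /andP[ij jM] eE.
have [l1 [l2 l3] l4 l5 l6] := mst_good_pair eps_small pclose (Emst c) (introT andP (conj ij jM)) eE.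
have iM : (i <= M)%N by apply: leq_trans jM; apply: ltnW.
split=> //.
- by rewrite -!mem_colour_class.
- by move=> d k /andP[h1 h2]; rewrite -mem_colour_class ?l4 ?h1 ?h2 //; apply: leq_trans jM; apply: ltnW.
- by move=> _ ab; rewrite -!mem_colour_class //; apply: l5.
Qed.

Lemma gap_edge c i j a b : (i < j <= M)%N -> s a i = c -> s b j = c ->
  (forall d k, (i < k < j)%N -> s d k != c) ->
  exists a' b', [set gpt M a' i; gpt M b' j] \in E c /\ good (fun a i => s a i == c) a' i b' j.
Proof.
move=> ijM sa sb gap; have /andP[ij jM] := ijM.
have iM : (i <= M)%N by apply: leq_trans jM; apply: ltnW.
have [||d k /andP[h1 h2]|a' [b' eE]] := @mst_gap_edge _ _ _ _ eps_small pclose _ _ i j a b (Emst c) ijM.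
- by rewrite mem_colour_class // sa.
- by rewrite mem_colour_class // sb.
- by rewrite mem_colour_class ?gap ?h1 //; apply: leq_trans jM; apply: ltnW.
by exists a', b'; split=> //; apply: good_colour.
Qed.

(** Each of the two columns has a single point of colour c, in opposite rows, which leaves only the
    diagonal. *)
Lemma diagonal_step k a c : (k.+1 <= M)%N -> s a k = c -> s (~~ a) k = ~~ c ->
  s a k.+1 = ~~ c -> s (~~ a) k.+1 = c -> [set gpt M a k; gpt M (~~ a) k.+1] \in E c.
Proof.
move=> kM s1 s2 s3 s4.
have [|d j|a' [b' [eE [_ [h1 h2] _ _ _]]]] := @gap_edge c k k.+1 a (~~ a) _ s1 s4.
- by rewrite ltnSn kM.
- by rewrite ltnS => /andP[h1]; rewrite leqNgt h1.
have -> : a = a' by apply/eqP/negPn/negP => ne; move: h1 s2; case: (a) ne; case: (a') => //= _ /eqP->; case: (c).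
suff -> : ~~ a' = b' by [].
have ea : a = a' by apply/eqP/negPn/negP => ne; move: h1 s2; case: (a) ne; case: (a') => //= _ /eqP->; case: (c).
move: h2 s3; rewrite ea; case: (a'); case: (b') => //= /eqP ->; by case: (c).
Qed.

Lemma tail_step k : (k.+1 <= M)%N -> s true k = ~~ s false k ->
  (forall a, s a k.+1 = ~~ s a k) ->
  (#|crossings_upto p E k| + 1 <= #|crossings_upto p E k.+1|)%N.
Proof.
move=> kM st sn; set c := s false k; have kM' : (k <= M)%N := ltnW kM.
pose e := [set gpt M false k; gpt M true k.+1]; pose f := [set gpt M true k; gpt M false k.+1].
have eE : e \in E c.
  by apply: (@diagonal_step k false c) => //; rewrite sn /= ?st ?negbK.
have fE : f \in E (~~ c).
  by apply: (@diagonal_step k true (~~ c)) => //; rewrite ?sn /= ?st ?negbK.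
have re : rcol e = k.+1 by rewrite rcol_set2 !col_gpt //; apply/maxn_idPr.
have rf : rcol f = k.+1 by rewrite rcol_set2 !col_gpt //; apply/maxn_idPr.
have ef : edges_cross p e f.
  apply/(edges_crossP pccw); first by rewrite /= !inE !gpt_eq //= ?andbF; lia.
  by rewrite /alternate /separates !pos_gpt //; lia.
apply: (@crossings_upto_add _ _ p E k k.+1 [:: colour_order c (e, f)]) => //=.
- by rewrite (mem_crossings_upto _ eE fE ef) re rf leqnn.
- by rewrite andbT; case: (c); rewrite /= ?re ?rf ltnSn.
Qed.

(** Here h is a row in which the jump between columns k + 1 and k + 3 is not longer than in the
    other; uniqueness of the tree settles a tie. *)
Lemma gadget_step k h c : (k + 4 <= M)%N ->
  (forall E', is_mst p (colour_class c) E' -> E' = E c) ->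
  s h k = ~~ c -> s (~~ h) k = c ->
  (forall a, s a (k + 1)%N = c) -> (forall a, s a (k + 2)%N = ~~ c) ->
  (forall a, s a (k + 3)%N = c) -> s h (k + 4)%N = ~~ c -> s (~~ h) (k + 4)%N = c ->
  dist (p (gpt M h (k + 1))) (p (gpt M h (k + 3))) <=
    dist (p (gpt M (~~ h) (k + 1))) (p (gpt M (~~ h) (k + 3))) ->
  (#|crossings_upto p E k| + 5 <= #|crossings_upto p E (k + 4)|)%N.
Proof.
move=> kM uniqE s0h s0n s1 s2 s3 s4h s4n tie.
have [k0 [k1 [k2 [k3 k4]]]] : (k <= M /\ k + 1 <= M /\ k + 2 <= M /\ k + 3 <= M /\ k + 4 <= M)%N by clear -kM; lia.
have bdic a : a = h \/ a = ~~ h by case: (a); case: (h); auto.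
have cN : (c == ~~ c) = false by case: (c).
have Nc : (~~ c == c) = false by case: (c).
(* The detour goes over the two vertical edges and the jump in row h. *)
have noH : [set gpt M (~~ h) (k + 1); gpt M (~~ h) (k + 3)] \notin E c.
  apply/negP=> eE; apply: (@unique_mst_no_shortcut _ _ p (colour_class c) (E c) _ _
    [:: gpt M h (k + 1); gpt M h (k + 3); gpt M (~~ h) (k + 3)] (Emst c) uniqE eE) => //=.
  rewrite !mem_colour_class // !s1 !s3 !eqxx /= tie.
  rewrite !set2_gpt_neq ?(ltW (dist_lt_gsqd eps_small pclose _)) //=;
    rewrite /gsqd ?col_gpt // ?row_gpt -?mulnn ?eqxx; case: (h) => //=; clear; lia.
have H13 : [set gpt M h (k + 1); gpt M h (k + 3)] \in E c.
  have [|d j|a [b [eE [_ _ _ diag _]]]] := @gap_edge c (k + 1) (k + 3) h h _ (s1 h) (s3 h).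
  - by clear -kM; lia.
  - by move=> hj; have -> : j = (k + 2)%N by [clear -hj; lia]; rewrite s2 Nc.
  have ab : a = b.
    apply/eqP/negPn/negP=> ne; have [|n1 n2] := diag _ ne; first by clear; lia.
    by move: n1; rewrite s1 eqxx.
  by case: (bdic a) eE noH => <-; rewrite -ab // => ->.
(* Column k offers only row h to this colour, and a slanted edge is excluded because column k + 2 is
   full. [H24] is the mirror image. *)
have H02 : [set gpt M h k; gpt M h (k + 2)] \in E (~~ c).
  have [|d j|a [b [eE [_ [ma _] _ diag _]]]] := @gap_edge (~~ c) k (k + 2) h h _ s0h (s2 h).
  - by clear -kM; lia.
  - by move=> hj; have -> : j = (k + 1)%N by [clear -hj; lia]; rewrite s1 cN.
  have ah : a = h by case: (bdic a) ma => -> //; rewrite s0n cN.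
  have ab : a = b.
    apply/eqP/negPn/negP=> ne; have [|n1 n2] := diag _ ne; first by clear; lia.
    by move: n2; rewrite s2 eqxx.
  by rewrite -{2}ah {1}ab -{1}ah.
have H24 : [set gpt M h (k + 2); gpt M h (k + 4)] \in E (~~ c).
  have [|d j|a [b [eE [_ [_ mb] _ diag _]]]] := @gap_edge (~~ c) (k + 2) (k + 4) h h _ (s2 h) s4h.
  - by clear -kM; lia.
  - by move=> hj; have -> : j = (k + 3)%N by [clear -hj; lia]; rewrite s3 cN.
  have bh : b = h by case: (bdic b) mb => -> //; rewrite s4n cN.
  have ab : a = b.
    apply/eqP/negPn/negP=> ne; have [|n1 n2] := diag _ ne; first by clear; lia.
    by move: n1; rewrite s2 eqxx.
  by rewrite -{2}bh -{1}bh -{1}ab.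
(* The cut isolates the point in row [~~ h]. The candidates in columns k and k + 4 lie in row h, and
   slanted edges at the full column k + 2 are excluded. *)
have V2 : [set gpt M false (k + 2); gpt M true (k + 2)] \in E (~~ c).
  apply: (@mst_vertical_edge _ _ p eps eps_small pclose _ _ _ (~~ h) false (Emst _)) => //.
  - by rewrite mem_colour_class // s2.
  - by rewrite mem_colour_class // s2.
  - move=> a j hj; apply/negP=> eE; have [_ [_ ma] emp diag _] := good_colour hj eE.
    have jk : (j <= k + 4)%N.
      rewrite leqNgt; apply/negP => lt; have := emp h (k + 4)%N.
      by rewrite s4h eqxx lt /= ?andbT => H; suff: false by []; apply: H; clear -lt hj; lia.
    have [ej|ej] : (j = k + 3 \/ j = k + 4)%N by clear -jk hj; lia.
      by move: ma; rewrite ej s3 cN.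
    have ah : a = h by case: (bdic a) ma => -> //; rewrite ej s4n cN.
    have [||n1 n2] := diag; [clear -hj; lia | by rewrite ah; case: (h) |].
    by move: n1; rewrite ah s2 eqxx.
  - move=> a j hj; apply/negP; rewrite addbF => eE.
    have [_ [ma _] emp diag _] := good_colour (introT andP (conj hj k2)) eE.
    have jk : (k <= j)%N.
      rewrite leqNgt; apply/negP => lt; have := emp h k.
      by rewrite s0h eqxx lt /= ?andbT => H; suff: false by []; apply: H; clear -lt hj; lia.
    have [ej|ej] : (j = k + 1 \/ j = k)%N by clear -jk hj; lia.
      by move: ma; rewrite ej s1 cN.
    have ah : a = h by case: (bdic a) ma => -> //; rewrite ej s0n cN.
    have [||n1 n2] := diag; [clear -hj; lia | by rewrite ah; case: (h) |].
    by move: n2; rewrite ah s2 eqxx.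
(* Here the cut takes along all columns to the left: an edge from row [~~ h] to column k + 3 is
   excluded by [noH] or is slanted, and an edge from column k into row h is slanted. [V3] exchanges
   the roles of left and right. *)
have V1 : [set gpt M false (k + 1); gpt M true (k + 1)] \in E c.
  apply: (@mst_vertical_edge _ _ p eps eps_small pclose _ _ _ (~~ h) true (Emst _)) => //.
  - by rewrite mem_colour_class // s1.
  - by rewrite mem_colour_class // s1.
  - move=> a j hj; apply/negP=> eE; have [_ [_ ma] emp diag _] := good_colour hj eE.
    have jk : (j <= k + 3)%N.
      rewrite leqNgt; apply/negP => lt; have := emp h (k + 3)%N.
      by rewrite s3 eqxx lt /= ?andbT => H; suff: false by []; apply: H; clear -lt hj; lia.
    have [ej|ej] : (j = k + 2 \/ j = k + 3)%N by clear -jk hj; lia.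
      by move: ma; rewrite ej s2 Nc.
    case: (bdic a) => ah; last by move: eE noH; rewrite ej ah => ->.
    have [||n1 n2] := diag; [clear -hj; lia | by rewrite ah; case: (h) |].
    by move: n1; rewrite s1 eqxx.
  - move=> a j hj; apply/negP; rewrite addbT negbK => eE.
    have [_ [ma _] emp diag _] := good_colour (introT andP (conj hj k1)) eE.
    have jk : (k <= j)%N.
      rewrite leqNgt; apply/negP => lt; have := emp (~~ h) k.
      by rewrite s0n eqxx lt /= ?andbT => H; suff: false by []; apply: H; clear -lt hj; lia.
    have ej : (j = k)%N by clear -jk hj; lia.
    have ah : a = ~~ h by case: (bdic a) ma => -> //; rewrite ej s0h Nc.
    have [||n1 n2] := diag; [clear -hj; lia | by rewrite ah; case: (h) |].
    by move: n2; rewrite s1 eqxx.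
have V3 : [set gpt M false (k + 3); gpt M true (k + 3)] \in E c.
  apply: (@mst_vertical_edge _ _ p eps eps_small pclose _ _ _ h true (Emst _)) => //.
  - by rewrite mem_colour_class // s3.
  - by rewrite mem_colour_class // s3.
  - move=> a j hj; apply/negP=> eE; have [_ [_ ma] emp diag _] := good_colour hj eE.
    have jk : (j <= k + 4)%N.
      rewrite leqNgt; apply/negP => lt; have := emp (~~ h) (k + 4)%N.
      by rewrite s4n eqxx lt /= ?andbT => H; suff: false by []; apply: H; clear -lt hj; lia.
    have ej : (j = k + 4)%N by clear -jk hj; lia.
    have ah : a = ~~ h by case: (bdic a) ma => -> //; rewrite ej s4h Nc.
    have [||n1 n2] := diag; [clear -hj; lia | by rewrite ah; case: (h) |].
    by move: n1; rewrite s3 eqxx.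
  - move=> a j hj; apply/negP; rewrite addbT => eE.
    have [_ [ma _] emp diag _] := good_colour (introT andP (conj hj k3)) eE.
    have jk : (k + 1 <= j)%N.
      rewrite leqNgt; apply/negP => lt; have := emp h (k + 1)%N.
      by rewrite s1 eqxx lt /= ?andbT => H; suff: false by []; apply: H; clear -lt hj; lia.
    have [ej|ej] : (j = k + 2 \/ j = k + 1)%N by clear -jk hj; lia.
      by move: ma; rewrite ej s2 Nc.
    case: (bdic a) => ah; last by move: eE noH; rewrite ej ah => ->.
    have [||n1 n2] := diag; [clear -hj; lia | by rewrite ah; case: (h) |].
    by move: n2; rewrite s3 eqxx.
(* The jump of colour c meets both jumps of the other colour and the vertical edge of column k + 2;
   each of those two jumps also meets one vertical edge of colour c. *)
pose L := [:: ([set gpt M h (k + 1); gpt M h (k + 3)], [set gpt M h k; gpt M h (k + 2)]);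
  ([set gpt M h (k + 1); gpt M h (k + 3)], [set gpt M h (k + 2); gpt M h (k + 4)]);
  ([set gpt M h (k + 1); gpt M h (k + 3)], [set gpt M false (k + 2); gpt M true (k + 2)]);
  ([set gpt M false (k + 1); gpt M true (k + 1)], [set gpt M h k; gpt M h (k + 2)]);
  ([set gpt M false (k + 3); gpt M true (k + 3)], [set gpt M h (k + 2); gpt M h (k + 4)])].
have crossL : all (fun ef : {set I} * {set I} => [&& ef.1 \in E c, ef.2 \in E (~~ c),
   k < rcol ef.1 <= k + 4 & rcol ef.2 <= k + 4]%N) L.
  rewrite /= H13 H02 H24 V1 V2 V3 !rcol_set2 !col_gpt //=; clear; lia.
have crossL2 ef : ef \in L -> edges_cross p ef.1 ef.2.
  rewrite !inE; clear -pccw kM k0 k1 k2 k3 k4 => /or4P[||| /orP[]] /eqP -> /=;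
    apply/(edges_crossP pccw);
    try (by rewrite /= !inE !gpt_eq //=; case: (h) => /=; clear; lia);
    rewrite /alternate /separates !pos_gpt //; case: (h); clear -kM; lia.
(* Right ends and sums of columns suffice to tell the five pairs apart. *)
have uL : uniq L.
  apply: (@map_uniq _ _ (fun ef : {set I} * {set I} => (rcol ef.1, sumcol ef.1, rcol ef.2, sumcol ef.2))).
  rewrite /= !rcol_set2 !sumcol_set2 ?gpt_eq //= ?eqxx /=; try (case: (h) => //=; clear; lia).
  rewrite !col_gpt // !inE !xpair_eqE; clear; lia.
rewrite -[X in (_ + X)%N]/(size L) -(size_map (colour_order c)).
apply: crossings_upto_add; first by rewrite leq_addr.
- by rewrite map_inj_uniq //; apply: colour_order_inj.
- apply/allP=> ? /mapP[[e f] efL ->]; have /and4P[eE fE /andP[_ r1] r2] := allP crossL _ efL.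
  by rewrite (mem_crossings_upto _ eE fE (crossL2 _ efL)) r1.
- apply/allP=> ? /mapP[[e f] efL ->]; have /and4P[_ _ /andP[r1 _] _] := allP crossL _ efL.
  by move: r1 => /=; case: (c) => /= ->; rewrite ?orbT.
Qed.
End Gadget.

(* Columns 0, 4, 8, ... carry one red point, in the lower row. Columns 1, 2, 3
   modulo 4 form a gadget, monochromatic in each column, while k / 4 < q; the
   at most three columns left at the right end alternate the two rows. *)
Definition gadget_colouring (q : nat) (h : nat -> bool) (a : bool) (k : nat) : bool :=
  if (k %% 4 == 0)%N then ~~ a
  else if (k %/ 4 < q)%N then (if (k %% 4 == 2)%N then ~~ h (k %/ 4)%N else h (k %/ 4)%N)
  else if (k %% 4 == 2)%N then ~~ a else a.

Lemma cr_lower_bound (R : realType) (M : nat) (p : 'I_M.+1 + 'I_M.+1 -> R * R) (eps : R) :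
  eps * M.+1%:R <= 1 / 100 -> close p eps -> ccw p ->
  (forall S, exists! E, is_mst p S E) -> ((5 * M) %/ 4 <= cr p)%N.
Proof.
move=> eps_small pclose pccw uniq_mst.
(* The row of the shorter jump in gadget g, the upper one on a tie. *)
pose h g := dist (p (gpt M true (4 * g + 1))) (p (gpt M true (4 * g + 3))) <=
            dist (p (gpt M false (4 * g + 1))) (p (gpt M false (4 * g + 3))).
pose q := (M %/ 4)%N; pose s := gadget_colouring q h.
have [E [Emst uniqE]] : exists E : bool -> {set {set 'I_M.+1 + 'I_M.+1}},
    (forall c, is_mst p (colour_class M s c) (E c)) /\
    (forall c E', is_mst p (colour_class M s c) E' -> E' = E c).
  have [E1 [m1 u1]] := uniq_mst (colour_class M s true).
  have [E0 [m0 u0]] := uniq_mst (colour_class M s false).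
  by exists (fun c => if c then E1 else E0); split=> [[]|[] E'] //; [move/u1 | move/u0].
have sE g r a : (r < 4)%N -> s a (4 * g + r)%N =
    if r == 0%N then ~~ a else if (g < q)%N then (if r == 2 then ~~ h g else h g)
    else if r == 2 then ~~ a else a.
  move=> r4; rewrite /s /gadget_colouring mulnC modnMDl divnMDl // (divn_small r4) addn0.
  by rewrite modn_small.
have gadgets g : (g <= q)%N -> (5 * g <= #|crossings_upto p E (4 * g)|)%N.
  elim: g => [|g IHg] gq; first by rewrite muln0.
  have gM : (4 * g + 4 <= M)%N.
    by move: gq; rewrite /q; clear; have := divn_eq M 4; lia.
  have s0 a : s a (4 * g)%N = ~~ a by rewrite -[(4 * g)%N]addn0 sE.
  have s4 a : s a (4 * g + 4)%N = ~~ a by rewrite -[(4 * g + 4)%N]addn0 -mulnSr sE.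
  (* With the colour c taken equal to the row [h g], the outer columns must satisfy [s a k = ~~ a]
     for either value of [h g], so neighbouring gadgets fit together. *)
  have := @gadget_step R M p eps eps_small pclose pccw s E Emst (4 * g) (h g) (h g) gM (uniqE (h g)).
  rewrite !s0 !s4 negbK => /(_ erefl erefl).
  have e1 a : s a (4 * g + 1)%N = h g by rewrite sE //= gq.
  have e2 a : s a (4 * g + 2)%N = ~~ h g by rewrite sE //= gq.
  have e3 a : s a (4 * g + 3)%N = h g by rewrite sE //= gq.
  move=> /(_ e1 e2 e3 erefl erefl) H; rewrite !mulnSr.
  apply: leq_trans (H _); first by rewrite leq_add2r IHg // ltnW.
  by case hg: (h g); move: hg; rewrite /h // => /negbT; rewrite -ltNge => /ltW.
have tail r : (r < 4)%N -> (4 * q + r <= M)%N ->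
    (5 * q + r <= #|crossings_upto p E (4 * q + r)|)%N.
  elim: r => [|r IHr] r4 rM; first by rewrite !addn0 gadgets.
  move: rM; rewrite !addnS => rM; rewrite -addn1.
  apply: leq_trans (tail_step eps_small pclose pccw Emst rM _ _).
  - by rewrite leq_add2r IHr // ltnW.
  - by rewrite !sE ?(ltnW r4) // ltnn /=; case: (r == 0)%N => //; case: (r == 2).
  - move=> a; rewrite -addnS !sE ?(ltnW r4) // ltnn /=.
    by case: r r4 {IHr rM} => [|[|[|]]] //=; rewrite negbK.
have eM : M = (4 * q + M %% 4)%N by rewrite mulnC -divn_eq.
(* For a remainder r < 4 the integer part of 5 r / 4 is r, so one crossing per leftover column is
   exactly enough. *)
have -> : ((5 * M) %/ 4 = 5 * q + M %% 4)%N.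
  have := ltn_pmod M (isT : (0 < 4)%N); move: (M %% 4)%N eM => r eM r4.
  by rewrite {1}eM; move: (q) r4; clear => k; lia.
apply: leq_trans (tail _ (ltn_pmod M (isT : (0 < 4)%N)) _) _; first by rewrite -eM.
rewrite -eM crossings_upto_all; apply: (@cr_ge _ _ p (colour_class M s true)) => //.
suff <- : colour_class M s false = ~: colour_class M s true by [].
by apply/setP=> x; rewrite !inE; case: (s _ _).
Qed.

(** * Upper bound *)

Section TightEdges.
Variable M : nat.
Implicit Types (s : bool -> nat -> bool) (a b c : bool) (i j k : nat).

(** Two features of the extremal perturbation are added to [good]: vertical edges shorten to the
    right, so a vertical edge in column i excludes a full column i + 1; and a jump between full
    columns uses the upper row exactly when j is even. *)
Definition tight_good s a i b j := [/\ good s a i b j,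
  i = j -> (i < M)%N -> ~~ (s false i.+1 && s true i.+1) &
  a = b -> (i.+1 < j)%N -> s (~~ a) i -> s (~~ a) j -> a = ~~ odd j].

Lemma tight_good_same_start s a i b b' j : tight_good s a i b j -> tight_good s a i b' j ->
  (i < j)%N -> b = b'.
Proof.
case=> [[_ [_ bj] _ d _] _ _] [[_ [_ bj'] _ d' _] _ _] ij.
apply/eqP/negPn/negP=> ne; case: (eqVneq a b) => ab.
  have [|_] := d' ij; first by rewrite ab.
  by rewrite ab bj.
have [_] := d ij ab; suff -> : a = b' by rewrite bj'.
by move: ne ab; case: (a); case: (b); case: (b').
Qed.

(** Both edges are straight, so columns i and j are full, and a jump between full columns is
    confined to one row. *)
Lemma tight_good_both_starts s b b' i j : tight_good s false i b j -> tight_good s true i b' j ->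
  (i < j)%N -> [/\ j = i.+1, s false j & s true j].
Proof.
case=> [[_ [s0 bj] _ d _] _ h] [[_ [s1 bj'] _ d' _] _ h'] ij.
have eb : b = false by apply/negbTE/negP=> e; have [] := d ij; rewrite e // s1.
have eb' : b' = true by apply/negbNE/negP=> /negbTE e; have [] := d' ij; rewrite e // s0.
subst b b'; split=> //; apply/eqP; rewrite eqn_leq ij andbT leqNgt; apply/negP=> lt.
by have := h' erefl lt s0 bj; rewrite -(h erefl lt s1 bj').
Qed.

Lemma tight_good_right_end s a i b j a' b' j' : tight_good s a i b j -> tight_good s a' i b' j' ->
  (i < j)%N -> (i < j')%N -> j = j'.
Proof.
case=> [[_ [_ bj] e _ _] _ _] [[_ [_ bj'] e' _ _] _ _] ij ij'.
case: (ltngtP j j') => // lt.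
  by have := e' b j; rewrite ij lt bj => /(_ isT).
by have := e b' j'; rewrite ij' lt bj' => /(_ isT).
Qed.

Lemma tight_good_left_end s a i b j a' i' b' : tight_good s a i b j -> tight_good s a' i' b' j ->
  (i < j)%N -> (i' < j)%N -> i = i'.
Proof.
case=> [[_ [ai _] e _ _] _ _] [[_ [ai' _] e' _ _] _ _] ij ij'.
case: (ltngtP i i') => // lt.
  by have := e a' i'; rewrite ij' lt ai' => /(_ isT).
by have := e' a i; rewrite ij lt ai => /(_ isT).
Qed.

(** At most one jump ends in a given column; hence each kind of crossing below occurs at most once
    per right end. *)
Lemma tight_good_jump_unique s a i b j a' i' b' :
  tight_good s a i b j -> tight_good s a' i' b' j -> (i.+1 < j)%N -> (i'.+1 < j)%N ->
  [/\ a = a', i = i' & b = b'].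
Proof.
move=> g g' ij ij'; have ei := tight_good_left_end g g' (ltnW ij) (ltnW ij').
subst i'; have ea : a = a'.
  case: a a' g g' => -[] // g g'.
    by have [ej _ _] := tight_good_both_starts g' g (ltnW ij); rewrite ej ltnn in ij.
  by have [ej _ _] := tight_good_both_starts g g' (ltnW ij); rewrite ej ltnn in ij.
by subst a'; split=> //; apply: tight_good_same_start g g' (ltnW ij).
Qed.

End TightEdges.

(** * Uniqueness of the minimum spanning tree from tightness *)

Section UniqueTree.
Variable M : nat.
Local Notation I := ('I_M.+1 + 'I_M.+1)%type.
Implicit Types (S : {set I}) (e : {set I}).

Definition tight_edge S e := exists a i b j,
  [/\ e = [set gpt M a i; gpt M b j], (j <= M)%N & tight_good M (fun a i => gpt M a i \in S) a i b j].

(* A non-vertical edge is charged to its left end, a vertical edge to an end that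
   is not already charged; this bounds the number of tight edges. *)
Definition charged S e x := x \in S /\
  ((exists a i b j, [/\ e = [set gpt M a i; gpt M b j], (i < j <= M)%N,
     tight_good M (fun a i => gpt M a i \in S) a i b j & x = gpt M a i]) \/
   (exists a i, [/\ e = [set gpt M false i; gpt M true i], (i <= M)%N, x = gpt M a i &
     forall b j, (i < j <= M)%N -> ~ tight_good M (fun a i => gpt M a i \in S) a i b j])).

Lemma charged_inj S e e' x : charged S e x -> charged S e' x -> e = e'.
Proof.
case=> _ h [_]; case: h => [[a [i [b [j [-> /andP[ij jM] g ->]]]]]|[a [i [-> iM -> nog]]]].
  have iM : (i <= M)%N by apply: leq_trans (ltnW ij) jM.
  case=> [[a' [i' [b' [j' [-> /andP[ij' jM'] g' eq]]]]]|[a' [i' [-> iM' eq nog]]]].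
    have iM' : (i' <= M)%N by apply: leq_trans (ltnW ij') jM'.
    have [ea ei] := gpt_inj iM iM' eq; subst a' i'.
    have ej := tight_good_right_end g g' ij ij'; subst j'.
    by rewrite (tight_good_same_start g g' ij).
  have [ea ei] := gpt_inj iM iM' eq; subst a' i'.
  by case: (nog b j); rewrite // ij jM.
case=> [[a' [i' [b' [j' [-> /andP[ij' jM'] g' eq]]]]]|[a' [i' [-> iM' eq _]]]].
  have iM' : (i' <= M)%N by apply: leq_trans (ltnW ij') jM'.
  have [ea ei] := gpt_inj iM iM' eq; subst a' i'.
  by case: (nog b' j'); rewrite // ij' jM'.
by have [_ ->] := gpt_inj iM iM' eq.
Qed.

(** Every edge can be charged, injectively, to a vertex other than one vertex z in the last column
    met by S. *)
Lemma card_tight_edges S (G : {set {set I}}) : (forall e, e \in G -> tight_edge S e) ->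
  (#|G| <= #|S|.-1)%N.
Proof.
move=> tG; have [S0|[x0 x0S]] := set_0Vmem S.
  rewrite S0 cards0 leqn0 cards_eq0; apply/eqP/setP=> e; rewrite inE; apply/negP=> /tG.
  case=> [a [i [b [j [_ _ [[_ [+ _] _ _ _] _ _]]]]]]; by rewrite S0 inE.
case: (arg_maxnP (fun x : I => col x) x0S) => y yS ymax.
(* In a full last column the vertical edge is charged to the lower point, so z is the upper one. *)
pose z := if gpt M true (col y) \in S then gpt M true (col y) else y.
have zS : z \in S by rewrite /z; case: ifP.
have cz : col z = col y by rewrite /z; case: ifP => // _; rewrite col_gpt ?col_le.
have maxS a i : (i <= M)%N -> gpt M a i \in S -> (i <= col y)%N.
  by move=> iM /ymax; rewrite /= col_gpt.
have tot e : e \in G -> exists x, charged S e x /\ x != z.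
  move/tG=> [a [i [b [j [-> jM tg]]]]].
  have [[ij [aS bS] _ _ vert] nofull _] := tg.
  have iM : (i <= M)%N by apply: leq_trans ij jM.
  have last c l d : (i < l <= M)%N -> tight_good M (fun a i => gpt M a i \in S) c i d l ->
      gpt M c i != z.
    case/andP=> il lM [[_ [_ dS] _ _ _] _ _]; apply/eqP=> ez; move: cz; rewrite -ez col_gpt // => ei.
    by move: il; rewrite ei ltnNge (maxS d).
  move: ij; rewrite leq_eqVlt => /orP[/eqP eij|ij]; last first.
    exists (gpt M a i); split; last by apply: last tg; rewrite ij jM.
    by split=> //; left; exists a, i, b, j; rewrite ij jM.
  subst j; have [ea eb] := vert erefl; subst a b.
  (* If the lower point already carries an edge to the right, the upper one takes the vertical edge:
     edges from both points would make column i + 1 full, which [nofull] forbids. *)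
  have [[d [l [ilM g]]]|none] := pselect (exists d l, (i < l <= M)%N /\
      tight_good M (fun a i => gpt M a i \in S) false i d l).
    have ilM' := ilM; case/andP: ilM' => il lM.
    exists (gpt M true i); split.
      split=> //; right; exists true, i; split=> // b j /andP[ij jM'] g'.
      have el := tight_good_right_end g g' il ij; subst l.
      have [ej s0 s1] := tight_good_both_starts g g' il.
      by move: (nofull erefl); rewrite -ej s0 s1 => /(_ lM).
    apply/eqP=> ez; move: cz; rewrite -ez col_gpt // => ei.
    by case: g => -[_ [_ dS] _ _ _] _ _; move: il; rewrite ei ltnNge (maxS d).
  exists (gpt M false i); split.
    split=> //; right; exists false, i; split=> // d l ilM g; apply: none; by exists d, l.
  apply/eqP=> ez; move: cz; rewrite -ez col_gpt // => ei.
  by move: ez; rewrite /z -ei bS => /gpt_inj[].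
pose phi e := odflt z [pick x | `[< charged S e x /\ x != z >]].
have phiP e : e \in G -> charged S e (phi e) /\ phi e != z.
  move=> /tot[x cx]; rewrite /phi; case: pickP => [x' /asboolP //|/(_ x)/asboolP //].
have : (#|phi @: G| <= #|S :\ z|)%N.
  apply/subset_leq_card/subsetP=> x /imsetP[e eG ->]; have [[pS _] pz] := phiP e eG.
  by rewrite !inE pz pS.
rewrite card_in_imset; last first.
  move=> e e' eG eG' ee; have [c1 _] := phiP e eG; have [c2 _] := phiP e' eG'.
  by apply: charged_inj c1 _; rewrite ee.
by rewrite (cardsD1 z S) zS.
Qed.

(** The union of two minimum trees consists of tight edges, hence has at most |S| - 1 of them, and
    each tree equals the union. *)
Lemma unique_mst_of_tight (R : realType) (p : I -> R * R) S :
  (forall E e, is_mst p S E -> e \in E -> tight_edge S e) -> exists! E, is_mst p S E.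
Proof.
move=> tE; have [E mE] := exists_mst p S; exists E; split=> // E' mE'.
have cE F : is_mst p S F -> #|F| = #|S|.-1 by case/andP=> /spanning_treeP[].
have : (#|E :|: E'| <= #|S|.-1)%N.
  by apply: card_tight_edges => e; rewrite inE => /orP[]; [exact: tE mE | exact: tE mE'].
move=> cU; have eqU F : is_mst p S F -> F \subset E :|: E' -> F = E :|: E'.
  by move=> mF sF; apply/eqP; rewrite eqEcard sF (cE F mF).
exact: etrans (eqU E mE (subsetUl _ _)) (esym (eqU E' mE' (subsetUr _ _))).
Qed.

End UniqueTree.

(** * How two tight edges of different colours can cross *)

Section CrossingCases.
Variable M : nat.
Variable s : bool -> nat -> bool.
Implicit Types (a b c d : bool) (i j k : nat).

Definition tight c := tight_good M (fun a i => s a i == c).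

Definition interleaved a i b j a' i' b' j' :=
  alternate (gpt M a i) (gpt M b j) (gpt M a' i') (gpt M b' j').

Lemma not_between c a i b j : tight c a i b j -> forall d k, (i < k < j)%N -> s d k = ~~ c.
Proof. by case=> [[_ _ e _ _] _ _] d k /(e d); case: (s d k); case: (c). Qed.

Lemma tight_straight c a i b j : tight c a i b j -> (i < j)%N ->
  s b i = c \/ s a j = c -> a = b.
Proof.
case=> [[_ _ _ d _] _ _] ij h; apply/eqP/negPn/negP=> ne; have [h1 h2] := d ij ne.
by case: h => h; [move: h1 | move: h2]; rewrite h eqxx.
Qed.

(** Columns strictly inside one edge are filled with the other colour, which restricts how the ends
    interleave. The outcomes are: two diagonals between neighbouring columns, a vertical edge under
    a jump ending one column later, and two jumps overlapping by one step whose inner ends share a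
    row. *)
Lemma crossing_cases c a i b j a' i' b' j' :
  tight c a i b j -> tight (~~ c) a' i' b' j' -> (j <= M)%N -> (j' <= M)%N ->
  interleaved a i b j a' i' b' j' -> (j <= j')%N ->
  [\/ [/\ i = i', j = j', j = i.+1, a' = ~~ a & b = ~~ a /\ b' = a],
      [/\ i = j, j' = i.+1, (i' < i)%N, a = false & b = true] |
      [/\ (i < i')%N, j = i'.+1, (j < j')%N & b = a']].
Proof.
move=> te tf jM jM' alt jj'.
have emp := not_between te; have emp' := not_between tf.
have cN d k : s d k = c -> s d k = ~~ c -> False by move=> ->; case: (c).
have [[ij [/eqP ai /eqP bj] _ _ vert] nofull _] := te.
have [[ij' [/eqP ai' /eqP bj'] _ _ vert'] _ _] := tf.
have iM : (i <= M)%N := leq_trans ij jM; have iM' : (i' <= M)%N := leq_trans ij' jM'.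
have full k : (i' < k < j')%N -> forall d, s d k = c by move=> h d; rewrite (emp' d k h) negbK.
move: alt; rewrite /interleaved /alternate /separates !pos_gpt // => alt.
have row_ne k d d' : s d k = c -> s d' k = ~~ c -> d' = ~~ d.
  by move=> h1 h2; case: d d' h1 h2 => -[] // h1 h2; case: (cN _ _ h1 h2).
move: ij; rewrite leq_eqVlt => /orP[/eqP eij|ij].
  have [ea eb] := vert eij; subst a b j.
  have both d : s d i = c by case: d.
  have ne : i <> i' by move=> e; subst i'; apply: cN (both a') ai'.
  have ne' : i <> j' by move=> e; subst j'; apply: cN (both b') bj'.
  have [i1 i2] : (i' < i < j')%N /\ True.
    move: ij'; rewrite leq_eqVlt => /orP[/eqP eij'|ij'].
      have [? ?] := vert' eij'; subst a' b' j'; clear -alt iM iM' ne; split=> //; lia.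
    split=> //; clear -alt iM iM' jM' ne ne' ij'; case: a' b' alt => -[] /= alt; lia.
  case/andP: i1 => i1 i3; apply: Or32; split=> //.
  apply/eqP; rewrite eqn_leq i3 andbT leqNgt; apply/negP=> lt.
  (* If the jump went beyond column i + 1, that column would be full of colour c, and a tight
     vertical edge could not stand in column i. *)
  have h d := full i.+1 _ d; have iM1 : (i < M)%N by apply: leq_trans i3 jM'.
  by move: (nofull erefl iM1); rewrite !h ?eqxx // lt (ltn_trans i1).
move: ij'; rewrite leq_eqVlt => /orP[/eqP eij'|ij'].
  have [? ?] := vert' eij'; subst a' b' j'; exfalso.
  have both d : s d i' = ~~ c by case: d.
  have ne : j <> i' by move=> e; subst i'; apply: cN bj (both b).
  by clear -alt iM iM' jM jj' ne ij; case: a b alt => -[] /= alt; lia.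
case: (ltngtP i i') => [ii|ii|ii].
- case: (leqP j i') => [ji|ij2].
    have ne : j = i' -> b <> a' by move=> e e'; subst; apply: cN bj ai'.
    exfalso; clear -alt ne iM iM' jM jM' ji ii ij ij'; case: a b a' b' alt ne => -[] [] [] /= alt ne; lia.
  have fi d : s d i' = ~~ c by apply: emp; rewrite ii ij2.
  move: jj'; rewrite leq_eqVlt => /orP[/eqP ejj|jj'].
    have eb := row_ne j _ _ bj; rewrite ejj in eb; have {}eb := eb _ bj'.
    have ea := tight_straight tf ij' (or_introl (fi b')); exfalso; subst j a' b'.
    clear -alt iM iM' jM' ij' ij ii; case: a b alt => -[] /= alt; lia.
  apply: Or33; split=> //.
    (* Otherwise column i' + 1 lies strictly inside both edges and would be filled with each of the
       two colours. *)
    apply/eqP; rewrite eqn_leq ij2 andbT leqNgt; apply/negP=> lt.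
    apply: (cN true i'.+1); first by apply: full; rewrite ltnSn (ltn_trans lt jj').
    by apply: emp; rewrite lt (ltn_trans ii).
  apply/eqP/negPn/negP=> ne.
  clear -alt ne iM iM' jM jM' jj' ii ij2; case: a b a' b' alt ne => -[] [] [] /= alt ne //; lia.
- have fi d : s d i = c by apply: full; rewrite ii (leq_trans ij).
  have ea := tight_straight te ij (or_introl (fi b)); exfalso; subst a.
  move: jj'; rewrite leq_eqVlt => /orP[/eqP ejj|jj'].
    subst j'; have eb := row_ne j _ _ bj bj'; subst b'.
    clear -alt iM iM' jM' ij' ij ii; case: b a' alt => -[] /= alt; lia.
  clear -alt iM iM' jM' ij' ij ii jj'; case: b a' b' alt => -[] [] /= alt; lia.
- subst i'; have ea := row_ne i _ _ ai ai'; subst a'.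
  move: jj'; rewrite leq_eqVlt => /orP[/eqP ejj|jj'].
    subst j'; have eb := row_ne j _ _ bj bj'; subst b'; apply: Or31.
    have eb : b = ~~ a.
      clear -alt iM jM ij; case: a b alt => -[] /= alt //; lia.
    split=> //; last by rewrite eb negbK.
    apply/eqP; rewrite eqn_leq ij andbT leqNgt; apply/negP=> lt.
    by apply: (cN true i.+1); [apply: full | apply: emp]; rewrite lt ltnSn.
  have fj d : s d j = c by apply: full; rewrite ij.
  have ea := tight_straight te ij (or_intror (fj a)); exfalso; subst b.
  clear -alt iM jM' jM ij jj'; case: a b' alt => -[] /= alt; lia.
Qed.

End CrossingCases.

Lemma card_le1_of_eq (T : finType) (A : {set T}) :
  (forall x y, x \in A -> y \in A -> x = y) -> (#|A| <= 1)%N.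
Proof. by move=> h; apply/card_le1_eqP => x y xA yA; apply: h. Qed.

(** * Counting crossings along runs of columns of one colour *)

Section UpperBound.
Variables (R : realType) (M : nat).
Local Notation I := ('I_M.+1 + 'I_M.+1)%type.
Variable p : I -> R * R.
Hypothesis pccw : ccw p.
Variables (s : bool -> nat -> bool) (E : bool -> {set {set I}}).
Local Notation tight := (tight M s).
Hypothesis Etight : forall c e, e \in E c -> exists a i b j,
  [/\ e = [set gpt M a i; gpt M b j], (j <= M)%N & tight c a i b j].
Implicit Types (a b c d : bool) (i j k l : nat) (ef : {set I} * {set I}).

Definition full c k := s false k = c /\ s true k = c.
Definition mixed k := s true k = ~~ s false k.
Definition full_run c k0 k := forall l, (k0 <= l <= k)%N -> full c l.

Definition mixed_crossing k ef := mixed k /\ mixed k.+1 /\ exists a, s a k = true /\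
  ef = ([set gpt M a k; gpt M (~~ a) k.+1], [set gpt M (~~ a) k; gpt M a k.+1]).

Definition vertical_crossing c k ef := exists a i b,
  [/\ ef = colour_order c ([set gpt M false k; gpt M true k], [set gpt M a i; gpt M b k.+1]),
      (i < k)%N & tight (~~ c) a i b k.+1].

Definition jump_crossing c k ef := exists a i b i' b',
  [/\ ef = colour_order c ([set gpt M a i; gpt M b i'.+1], [set gpt M b i'; gpt M b' k.+1]),
      (i < i' < k)%N, tight c a i b i'.+1 & tight (~~ c) b i' b' k.+1].

Definition new_crossings k := crossings_upto p E k.+1 :\: crossings_upto p E k.

Lemma full_at c k : full c k <-> forall d, s d k = c.
Proof. by split=> [[h0 h1] [] //|h]; split. Qed.

Lemma full_colour c c' k : full c k -> full c' k -> c = c'.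
Proof. by case=> <- _ [<-]. Qed.

Lemma full_not_mixed c k : full c k -> ~ mixed k.
Proof. by case=> h0 h1; rewrite /mixed h0 h1; case: (c). Qed.

Lemma full_or_mixed k : mixed k \/ full (s false k) k.
Proof.
rewrite /mixed /full; case: (s true k); case: (s false k); by [left | right].
Qed.

Lemma tight_ends c a i b j : tight c a i b j -> [/\ (i <= j)%N, s a i = c & s b j = c].
Proof. by case=> [[ij [/eqP ai /eqP bj] _ _ _] _ _]. Qed.

Lemma tight_between c a i b j k : tight (~~ c) a i b j -> (i < k < j)%N -> full c k.
Proof. by move=> t h; apply/full_at => d; rewrite (not_between t d h) negbK. Qed.

(** [crossing_cases] is applied with the edge that ends first as its first edge; c is the colour of
    that edge, and in the last two cases column k lies inside the other edge. *)
Lemma new_crossing_cases k ef : (k.+1 <= M)%N -> ef \in new_crossings k ->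
  mixed_crossing k ef \/ exists c, full c k /\ (vertical_crossing c k ef \/ jump_crossing c k ef).
Proof.
move=> kM; have kM' := ltnW kM.
have key c e f : e \in E c -> f \in E (~~ c) -> edges_cross p e f ->
    (rcol e <= rcol f)%N -> rcol f = k.+1 ->
    mixed_crossing k (colour_order c (e, f)) \/ exists c', full c' k /\
    (vertical_crossing c' k (colour_order c (e, f)) \/ jump_crossing c' k (colour_order c (e, f))).
  move=> /Etight[a [i [b [j [-> jM te]]]]] /Etight[a' [i' [b' [j' [-> jM' tf]]]]] ecf.
  have [ij ai bj] := tight_ends te; have [ij' ai' bj'] := tight_ends tf.
  have iM := leq_trans ij jM; have iM' := leq_trans ij' jM'.
  rewrite !rcol_set2 !col_gpt // (maxn_idPr ij) (maxn_idPr ij') => jj' ej'; subst j'.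
  have cN d l d' l' : s d l = c -> s d' l' = ~~ c -> (d == d') && (l == l') = false.
    by move=> h1 h2; apply/negP=> /andP[/eqP ed /eqP el]; move: h2; rewrite -ed -el h1; case: (c).
  have d1 : (a == b) && (i == j) = false.
    by apply/negP=> /andP[/eqP ea /eqP ei]; case: te => -[_ _ _ _ /(_ ei)[e1 e2]] _ _; rewrite ea e2 in e1.
  have d2 : (a' == b') && (i' == k.+1) = false.
    by apply/negP=> /andP[/eqP ea /eqP ei]; case: tf => -[_ _ _ _ /(_ ei)[e1 e2]] _ _; rewrite ea e2 in e1.
  have un : uniq [:: gpt M a i; gpt M b j; gpt M a' i'; gpt M b' k.+1].
    rewrite /= !inE !gpt_eq // d1 d2.
    by rewrite (cN _ _ _ _ ai ai') (cN _ _ _ _ ai bj') (cN _ _ _ _ bj ai') (cN _ _ _ _ bj bj').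
  have alt := (edges_crossP pccw un).1 ecf.
  case: (crossing_cases te tf jM kM alt jj').
  - case=> ei ej [] eij ea' [eb eb']; subst i' j a' b b'; case: eij => eij; subst i.
    left; rewrite /mixed_crossing /mixed.
    have m0 : s true k = ~~ s false k by case: (a) ai ai' => /= -> ->; case: (c).
    have m1 : s true k.+1 = ~~ s false k.+1 by case: (a) bj bj' => /= -> ->; case: (c).
    split=> //; split=> //; case: c ai ai' {te tf ecf bj bj' cN} => ai ai'.
      by exists a.
    by exists (~~ a); rewrite negbK.
  - case=> eij ej' i1 ea eb; right; exists c; subst j a b; case: ej' => ej'; subst i.
    split; first by apply: (tight_between tf); rewrite i1 ltnSn.
    by left; exists a', i', b'; split.
  case=> i1 ej i2 eb; subst j a'; right; exists c.
  have ik : (i' < k)%N by rewrite -ltnS.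
  split; first by apply: (tight_between tf); rewrite ik ltnSn.
  by right; exists a, i, b, i', b'; rewrite i1 ik.
case: ef => e f; rewrite !inE /= => /andP[nk /andP[/and3P[eE fE /asboolP ecf] /andP[re rf]]].
rewrite eE fE (introT (asboolP _) ecf) /= negb_and -!ltnNge in nk.
case: (leqP (rcol e) (rcol f)) => [le|/ltnW le].
  apply: (key true e f) => //; apply/eqP; rewrite eqn_leq rf /=.
  by case/orP: nk => // h; apply: leq_trans le.
apply: (key false f e) => //; first exact: edges_crossC.
apply/eqP; rewrite eqn_leq re /=.
by case/orP: nk => // h; apply: leq_trans le.
Qed.

Lemma mixed_crossing_unique k ef ef' : mixed_crossing k ef -> mixed_crossing k ef' -> ef = ef'.
Proof.
case=> m [_ [a [ha ->]]] [_ [_ [a' [ha' ->]]]]; suff -> : a = a' by [].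
by move: m ha ha'; rewrite /mixed; case: a; case: a' => // -> ; case: (s false k).
Qed.

Lemma vertical_crossing_unique c k ef ef' :
  vertical_crossing c k ef -> vertical_crossing c k ef' -> ef = ef'.
Proof.
case=> a [i [b [-> ik t]]] [a' [i' [b' [-> ik' t']]]].
by have [-> -> ->] := tight_good_jump_unique t t' ik ik'.
Qed.

Lemma jump_crossing_unique c k ef ef' : jump_crossing c k ef -> jump_crossing c k ef' -> ef = ef'.
Proof.
case=> a [i [b [j [b' [-> /andP[ij jk] t t1]]]]] [a' [i' [d [j' [d' [-> /andP[ij' jk'] t' t1']]]]]].
have [eb ej ->] := tight_good_jump_unique t1 t1' jk jk'; subst d j'.
by have [-> -> _] := tight_good_jump_unique t t' ij ij'.
Qed.

Lemma new_crossings_mixed k : (k.+1 <= M)%N -> mixed k -> (#|new_crossings k| <= 1)%N.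
Proof.
move=> kM mk; apply: card_le1_of_eq => x y /(new_crossing_cases kM) hx /(new_crossing_cases kM) hy.
case: hx => [hx|[c [/full_not_mixed //]]].
by case: hy => [hy|[c [/full_not_mixed //]]]; apply: mixed_crossing_unique hx hy.
Qed.

Lemma new_crossings0 k : (k.+1 <= M)%N -> (mixed k -> ~ mixed k.+1) ->
  (forall c a i b, full c k -> (i < k)%N -> ~ tight (~~ c) a i b k.+1) -> #|new_crossings k| = 0%N.
Proof.
move=> kM hm hc; apply/eqP; rewrite cards_eq0; apply/eqP/setP=> ef; rewrite in_set0.
apply/negP=> /(new_crossing_cases kM)[[mk [mk1 _]]|[c [fk]]]; first exact: hm mk1.
case=> [[a [i [b [_ ik]]]]|[a [i [b [i' [b' [_ /andP[_ ik] _]]]]]]].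
  exact: hc fk ik.
exact: hc fk ik.
Qed.

Lemma new_crossings_run c k : (k.+1 <= M)%N -> full c k ->
  (#|new_crossings k| <= 2)%N /\ ((forall ef, ~ jump_crossing c k ef) -> (#|new_crossings k| <= 1)%N).
Proof.
move=> kM fk.
have cases ef : ef \in new_crossings k -> vertical_crossing c k ef \/ jump_crossing c k ef.
  case/(new_crossing_cases kM) => [[/(full_not_mixed fk)]//|[c' [fk']]].
  by rewrite (full_colour fk' fk).
split; last first.
  move=> nj; apply: card_le1_of_eq => x y /cases[hx|/nj//] /cases[hy|/nj//].
  exact: vertical_crossing_unique hx hy.
pose A := [set ef in new_crossings k | `[< vertical_crossing c k ef >]].
pose B := [set ef in new_crossings k | `[< jump_crossing c k ef >]].
have A1 : (#|A| <= 1)%N.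
  apply: card_le1_of_eq => x y; rewrite 2!inE => /andP[_ /asboolP hx].
  by rewrite 2!inE => /andP[_ /asboolP hy]; apply: vertical_crossing_unique hx hy.
have B1 : (#|B| <= 1)%N.
  apply: card_le1_of_eq => x y; rewrite 2!inE => /andP[_ /asboolP hx].
  by rewrite 2!inE => /andP[_ /asboolP hy]; apply: jump_crossing_unique hx hy.
apply: leq_trans (leq_add A1 B1); apply: leq_trans (leq_card_setU A B).1.
apply/subset_leq_card/subsetP=> ef h; apply/setUP.
by case: (cases ef h) => hh; [left | right]; rewrite in_set h; apply/asboolP.
Qed.

(* A jump crossing of the run k0..k of colour c joins the run of the other
   colour ending at k0 - 1 with a point of colour c in front of that run. *)
Lemma jump_crossing_run c k0 k ef : full_run c k0 k -> (0 < k0 <= k)%N -> ~ full c k0.-1 ->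
  jump_crossing c k ef -> exists a i b b', [/\ (i < k0.-1)%N, full (~~ c) k0.-1,
    forall l, (i < l < k0)%N -> full (~~ c) l, tight c a i b k0 & tight (~~ c) b k0.-1 b' k.+1].
Proof.
move=> run /andP[k0p k0k] nf [a [i [b [i' [b' [_ /andP[ii' ik] t t']]]]]].
have [_ _ bc] := tight_ends t; have [_ bi' _] := tight_ends t'.
have nc d l : s d l = ~~ c -> ~ full c l.
  by move=> h /full_at/(_ d); rewrite h; case: (c).
have ei : i' = k0.-1.
  case: (ltngtP i' k0.-1) => // lt.
    by case: nf; apply: (tight_between t'); clear -lt k0k k0p; lia.
  by case: (nc b i' bi'); apply: run; clear -lt ik; lia.
have ek : i'.+1 = k0 by rewrite ei prednK.
exists a, i, b, b'; rewrite -ei; rewrite -ek; split=> //.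
  by have := t; rewrite -{1}[c]negbK => /tight_between; apply; rewrite ii' ltnSn.
by move=> l hl; have := t; rewrite -{1}[c]negbK => /tight_between; apply.
Qed.

(** The state at the start k0 of a run of colour c, with n crossings counted; the cases differ in
    what precedes the run, hence in which jump crossings can occur. A column brings 5 units and a
    crossing costs 4; after the first run the balance 5 k0 - 4 n is at least 5, 6 or 3. Balance 3
    just pays for two crossings at the end of a run of length one. *)
Inductive run_state c k0 (n : nat) : Prop :=
| FirstRun of k0 = 0%N & n = 0%N
| RunWithoutJump of (0 < k0)%N & mixed k0.-1 \/ full_run (~~ c) 0 k0.-1 & (4 * n + 5 <= 5 * k0)%N
| RunAfterMixed k1 of (0 < k1 < k0)%N & full_run (~~ c) k1 k0.-1 & mixed k1.-1 &
    (4 * n + 6 <= 5 * k0)%N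
| RunAfterFull k1 of (0 < k1 < k0)%N & full_run (~~ c) k1 k0.-1 & full c k1.-1 &
    (4 * n + 3 <= 5 * k0)%N.

(** The two jumps of a jump crossing share a row, but their rows are given by the parities of k0 and
    k + 1, which differ when the run length is odd. *)
Lemma no_jump_crossing_odd c k0 k1 k ef : (0 < k1 < k0)%N -> (k0 <= k)%N ->
  full_run c k0 k -> full_run (~~ c) k1 k0.-1 -> full c k1.-1 -> full (~~ c) k.+1 ->
  odd (k.+1 - k0) -> ~ jump_crossing c k ef.
Proof.
case/andP=> k1p k10 k0k run run1 f1 fk oddk jc.
have k0p : (0 < k0)%N by apply: leq_trans k10.
have nf d l : full c l -> full d l -> d = ~~ c -> False.
  by move=> h1 h2 e; have := full_colour h1 h2; rewrite e; case: (c).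
have f0 : full (~~ c) k0.-1 by apply: run1; clear -k10; lia.
have [|h|a [i [b [b' [ik _ fb t t']]]]] := jump_crossing_run run _ _ jc.
- by rewrite k0p.
- exact: nf h f0 erefl.
have [_ ai bj] := tight_ends t; have [_ bi' bj'] := tight_ends t'.
have ei : i = k1.-1.
  case: (ltngtP i k1.-1) => // lt.
    by apply: False_ind; apply: nf f1 (fb k1.-1 _) erefl; clear -lt k10 k1p; lia.
  have /full_at/(_ a) : full (~~ c) i by apply: run1; clear -lt ik; lia.
  by rewrite ai; case: (c).
have fi d : s d i = c by rewrite ei; move: d; apply/full_at.
have f0' d : s d k0.-1 = ~~ c by move: d; apply/full_at.
have fk0 d : s d k0 = c by move: d; apply/full_at/run; rewrite leqnn.
have fk' d : s d k.+1 = ~~ c by move: d; apply/full_at.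
have ab : a = b by apply: (tight_straight t) (or_introl (fi b)); clear -ik k0p; lia.
have bb : b = b' by apply: (tight_straight t') (or_introl (f0' b')); clear -k0k k0p; lia.
have e1 : a = ~~ odd k0.
  by case: t => _ _ h; apply: h; rewrite ?fi ?fk0 ?eqxx //; clear -ik k0p; lia.
have e2 : b = ~~ odd k.+1.
  by case: t' => _ _ h; apply: h; rewrite ?f0' ?fk' ?eqxx // prednK.
move: oddk; rewrite oddB 1?ltnW //; move: e1; rewrite ab e2 => /negb_inj ->.
by rewrite addbb.
Qed.

(** The crossings counted at column k + 1 are paid for by all columns of the run. *)
Lemma run_step c k0 k n : (k0 <= k)%N -> (k.+1 <= M)%N -> full_run c k0 k -> run_state c k0 n ->
  (4 * (n + #|new_crossings k|) <= 5 * k.+1)%N /\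
  (full (~~ c) k.+1 -> run_state (~~ c) k.+1 (n + #|new_crossings k|)).
Proof.
move=> k0k kM run st.
have fk : full c k by apply: run; rewrite k0k leqnn.
have [le2 le1] := new_crossings_run kM fk.
have runN : full_run (~~ ~~ c) k0 k.+1.-1 by rewrite negbK.
have cN : ~ (c = ~~ c) by case: (c).
case: st => [ek -> | k0p prev bn | k1 k10 run1 m1 bn | k1 k10 run1 f1 bn].
- have -> : #|new_crossings k| = 0%N.
    apply: new_crossings0 => //; first by move=> /(full_not_mixed fk).
    move=> c' a i b fk' ik /tight_ends[_ ai _]; have ec := full_colour fk' fk; subst c'.
    have /full_at/(_ a) : full c i by apply: run; rewrite ek /= ltnW.
    by rewrite ai => /esym/cN.
  split=> // _; apply: RunWithoutJump => //; first by right; rewrite -ek.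
  by clear; lia.
- have /le1 d1 : forall ef, ~ jump_crossing c k ef.
    move=> ef jc; have [|h|a [i [b [b' [ik f0 _ t t']]]]] := jump_crossing_run run _ _ jc.
    + by rewrite k0p.
    + case: prev => [/(full_not_mixed h)//|/(_ k0.-1)].
      by rewrite leqnn => /(_ isT)/(full_colour h).
    have [_ ai _] := tight_ends t.
    case: prev => [/(full_not_mixed f0)//|/(_ i (ltnW ik))/full_at/(_ a)].
    by rewrite ai.
  split; first by clear -d1 bn k0k; lia.
  move=> _; case: prev => [m0|run0].
    by apply: (RunAfterMixed (k1 := k0)); rewrite ?k0p //; clear -d1 bn k0k; lia.
  apply: (RunAfterFull (k1 := k0)); rewrite ?k0p //.
    by apply: run0; rewrite leqnn.
  by clear -d1 bn k0k; lia.
- have k0p : (0 < k0)%N by case/andP: k10 => _; apply: leq_trans.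
  split; first by clear -le2 bn k0k; lia.
  move=> _; apply: (RunAfterFull (k1 := k0)); rewrite ?k0p //.
    by apply: run1; clear -k10; lia.
  by clear -le2 bn k0k; lia.
have k0p : (0 < k0)%N by case/andP: k10 => _; apply: leq_trans.
split; first by clear -le2 bn k0k; lia.
move=> fk1; apply: (RunAfterFull (k1 := k0)); rewrite ?k0p //.
  by apply: run1; clear -k10; lia.
(* An odd run brings at least 5 for one crossing, an even run at least 10 for two, so the balance 3
   is kept. *)
have [odk|] := boolP (odd (k.+1 - k0)).
  have d1 : (#|new_crossings k| <= 1)%N.
    by apply: le1 => ef; apply: no_jump_crossing_odd run run1 f1 fk1 odk.
  by clear -d1 bn k0k; lia.
by clear -le2 bn k0k; lia.
Qed.

Definition counting_invariant k :=
  (mixed k /\ (4 * #|crossings_upto p E k| <= 5 * k)%N) \/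
  exists c k0, [/\ (k0 <= k)%N, full_run c k0 k & run_state c k0 #|crossings_upto p E k|].

Lemma crossings_upto_step k :
  #|crossings_upto p E k.+1| = (#|crossings_upto p E k| + #|new_crossings k|)%N.
Proof.
rewrite /new_crossings -(cardsID (crossings_upto p E k) (crossings_upto p E k.+1)).
congr (_ + _)%N; congr #|pred_of_set _|; apply/setIidPr/subsetP=> ef; rewrite !inE.
by case/andP=> -> /andP[h1 h2]; rewrite /= !leqW.
Qed.

(** Edges ending in column 0 are vertical, and a column cannot carry vertical edges of both
    colours. *)
Lemma crossings_upto0 : #|crossings_upto p E 0| = 0%N.
Proof.
apply/eqP; rewrite cards_eq0; apply/eqP/setP=> -[e f]; rewrite in_set0; apply/negP.
rewrite !inE /= => /andP[/and3P[/Etight[a [i [b [j [-> jM t]]]]]]].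
case/Etight=> [a' [i' [b' [j' [-> jM' t']]]]] _ /andP[].
have [ij ai bj] := tight_ends t; have [ij' ai' bj'] := tight_ends t'.
rewrite !rcol_set2 !col_gpt ?(leq_trans ij) ?(leq_trans ij') //.
rewrite (maxn_idPr ij) (maxn_idPr ij') !leqn0 => /eqP ej /eqP ej'; subst j j'.
move: ij ij'; rewrite !leqn0 => /eqP ei /eqP ei'; subst i i'.
case: t t' => -[_ _ _ _ /(_ erefl)[ea eb]] _ _ [[_ _ _ _ /(_ erefl)[ea' eb']] _ _].
by move: ai ai'; rewrite ea ea' => ->.
Qed.

Lemma counting_invariant_holds k : (k <= M)%N -> counting_invariant k.
Proof.
elim: k => [|k IHk] kM.
  have [m0|f0] := full_or_mixed 0; first by left; rewrite crossings_upto0.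
  right; exists (s false 0), 0%N; split=> //; first by move=> l; rewrite leqn0 => /eqP ->.
  by rewrite crossings_upto0; apply: FirstRun.
have single c : full c k.+1 -> full_run c k.+1 k.+1.
  by move=> f l; rewrite -eqn_leq => /eqP <-.
rewrite /counting_invariant crossings_upto_step.
case: (IHk (ltnW kM)) => [[mk bn]|[c [k0 [k0k run st]]]].
  have le1 := new_crossings_mixed kM mk.
  have [m1|f1] := full_or_mixed k.+1; first by left; split=> //; clear -bn le1; lia.
  have -> : #|new_crossings k| = 0%N.
    apply: new_crossings0 => //; first by move=> _ /(full_not_mixed f1).
    by move=> c a i b /full_not_mixed.
  right; exists (s false k.+1), k.+1; split; [by [] | exact: single |].
  by apply: RunWithoutJump; [by [] | by left | clear -bn; lia].
have [m1|f1] := full_or_mixed k.+1.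
  by left; have [] := run_step k0k kM run st.
right; have [ec|ec] := eqVneq (s false k.+1) c; last first.
  have {}ec : s false k.+1 = ~~ c by move: ec; case: (s _ _); case: (c).
  rewrite ec in f1; exists (~~ c), k.+1; split; [by [] | exact: single |].
  by have [_] := run_step k0k kM run st; apply.
rewrite ec in f1; have fk : full c k by apply: run; rewrite k0k leqnn.
exists c, k0; split; first by apply: leqW.
  move=> l /andP[h1]; rewrite leq_eqVlt => /orP[/eqP->//|h2].
  by apply: run; rewrite h1.
(* While the run continues, no edge of the other colour ends in column k + 1, so nothing is
   added. *)
rewrite new_crossings0 ?addn0 //; first by move=> /(full_not_mixed fk).
move=> c' a i b fk' _ /tight_ends[_ _ bk]; have ec' := full_colour fk' fk; subst c'.
by have := (full_at _ _).1 f1 b; rewrite bk; case: (c).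
Qed.

Lemma crossings_upper_bound : (crossings p (E true) (E false) <= (5 * M) %/ 4)%N.
Proof.
rewrite -crossings_upto_all leq_divRL // mulnC.
case: (counting_invariant_holds (leqnn M)) => [[_ //]|[c [k0 [k0M _ st]]]].
case: st => [_ -> //|_ _|k1 _ _ _|k1 _ _ _]; clear -k0M; lia.
Qed.

End UpperBound.

(** * The extremal perturbation *)

Section NearGridFacts.
Variables (R : realType) (M : nat).
Local Notation I := ('I_M.+1 + 'I_M.+1)%type.
Variable p : I -> R * R.

Lemma close_injective eps : eps * M.+1%:R <= 1 / 100 -> close p eps -> injective p.
Proof.
move=> es pc x y exy; apply/eqP/negPn/negP=> ne.
have : dist (p x) (p x) < dist (p x) (p y).
  apply: (dist_lt_gsqd es pc); rewrite /gsqd !subnn eqxx.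
  have : ~~ ((row x == row y) && (col x == col y)).
    by apply: contra ne => /andP[/eqP r /eqP c]; rewrite -(gptK x) -(gptK y) r c.
  by case: eqP => //= _; rewrite -!mulnn; clear; nia.
by rewrite exy ltxx.
Qed.

Lemma ccw_general_position : ccw p -> general_position p.
Proof.
move=> hccw x y z xy yz xz; rewrite /collinear -/(orient (p x) (p y) (p z)) => e.
by have := ccw_orient_sign hccw xy yz xz; rewrite e ltxx; case: ifP.
Qed.

(** A convex combination of points at which an affine function is positive cannot give it the value
    0. *)
Lemma convex_position_support :
  (forall x, exists u : R * R * R, u.1.1 * (p x).1 + u.1.2 * (p x).2 + u.2 = 0 /\
     forall y, y != x -> 0 < u.1.1 * (p y).1 + u.1.2 * (p y).2 + u.2) -> convex_position p.
Proof.
move=> h x [lam [lam0 lamx lam1 e1 e2]]; have [[[u1 u2] u3] /= [ux uy]] := h x.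
have z : \sum_y lam y * (u1 * (p y).1 + u2 * (p y).2 + u3) = 0.
  under eq_bigr do rewrite !mulrDr (mulrCA _ u1) (mulrCA _ u2) (mulrC _ u3).
  by rewrite !big_split /= -!mulr_sumr e1 e2 lam1 mulr1.
have ge0 y : true -> 0 <= lam y * (u1 * (p y).1 + u2 * (p y).2 + u3).
  move=> _; have [->|/uy h'] := eqVneq y x; first by rewrite ux mulr0.
  by rewrite mulr_ge0 ?lam0 // ltW.
have all0 := psumr_eq0P ge0 z.
suff : \sum_y lam y = 0 by rewrite lam1 => /eqP; rewrite oner_eq0.
rewrite big1 // => y _; have [->//|ne] := eqVneq y x.
have /eqP := all0 y isT; rewrite mulf_eq0 => /orP[/eqP//|/eqP e].
by have := uy y ne; rewrite e ltxx.
Qed.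

Lemma dist_le_norms (a b : R * R) : dist a b <= `|a.1 - b.1| + `|a.2 - b.2|.
Proof.
set u := a.1 - b.1; set v := a.2 - b.2.
have n0 : 0 <= `|u| + `|v| by rewrite addr_ge0.
rewrite -[X in _ <= X](ger0_norm n0) -[X in _ <= X]sqrtr_sqr; apply: ler_wsqrtr.
rewrite (sqrrD `|u| `|v|) !real_normK ?num_real //.
have : 0 <= `|u| * `|v| by rewrite mulr_ge0.
rewrite /u /v; lra.
Qed.

Lemma norms_le_dist (a b : R * R) : `|a.1 - b.1| <= dist a b /\ `|a.2 - b.2| <= dist a b.
Proof.
by split; rewrite -sqrtr_sqr; apply: ler_wsqrtr; rewrite ?lerDl ?lerDr sqr_ge0.
Qed.

End NearGridFacts.

Lemma near_grid_close (R : realType) M (eps : R) (v w : 'I_M.+1 -> R * R) :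
  near_grid eps v w -> close (grid_pts v w) eps.
Proof.
move=> h [] i; have [hv hw] := h i; rewrite /= .
  by have [h1 h2] := norms_le_dist (v i) (i.+1%:R, 0); split; apply: le_trans hv.
by have [h1 h2] := norms_le_dist (w i) (i.+1%:R, 1); split; apply: le_trans hw.
Qed.

Lemma close_near_grid (R : realType) M (eps : R) (v w : 'I_M.+1 -> R * R) :
  close (grid_pts v w) eps -> near_grid (2 * eps) v w.
Proof.
move=> h i; have [h1 h2] := h (inl i); have [h3 h4] := h (inr i).
split; apply: le_trans (dist_le_norms _ _) _; rewrite mulr2n mulrDl !mul1r; exact: lerD.
Qed.

Definition abscissa (R : realType) (i : nat) : R := i.+1%:R.

(** * Two parabolic rows with an alternating shift, and their edge lengths *)

Section Example.
Variables (R : realType) (M : nat) (t : R).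
Local Notation I := ('I_M.+1 + 'I_M.+1)%type.
Local Notation N := (abscissa R M).
Local Notation x_ := (abscissa R).
Hypothesis t_gt0 : 0 < t.
Hypothesis t_small : t * N ^+ 3 <= 1 / 100 * (1 / 100).

(* Both rows lie on parabolas. The alternating horizontal shift in the lower row
   makes the shorter of v_i v_j and w_i w_j depend only on the parity of j; the
   summand 20 N^2 t makes vertical edges longer than edges v_i v_(i+1), w_i w_(i+1). *)
Definition shifted (i : nat) : R := x_ i * (if odd i then 1 - t else 1 + t).
Definition lower (i : nat) : R * R := (shifted i, t * shifted i ^+ 2).
Definition upper (i : nat) : R * R := (x_ i, 1 + 20 * N ^+ 2 * t - t * x_ i ^+ 2).
Definition example : I -> R * R :=
  grid_pts (fun i : 'I_M.+1 => lower i) (fun i : 'I_M.+1 => upper i).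

Lemma exampleE x : example x = if row x then upper (col x) else lower (col x).
Proof. by case: x. Qed.

Lemma N_ge1 : 1 <= N. Proof. by rewrite /abscissa ler1n. Qed.

Lemma abscissaS i : x_ i.+1 = x_ i + 1.
Proof. by rewrite /abscissa natr1. Qed.

Lemma abscissa_lt i j : (i < j)%N -> x_ i + 1 <= x_ j.
Proof. by rewrite -abscissaS /abscissa ler_nat. Qed.

Lemma tN2 : t * N ^+ 2 <= 1 / 100.
Proof.
apply: le_trans (le_trans t_small _); last by lra.
rewrite ler_wpM2l ?(ltW t_gt0) //.
by rewrite [N ^+ 3]exprS ler_peMl ?N_ge1 // sqr_ge0.
Qed.

Lemma tN : t * N <= 1 / 100.
Proof.
apply: le_trans tN2; rewrite ler_wpM2l ?(ltW t_gt0) //.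
by rewrite expr2 ler_peMl ?N_ge1 // (le_trans ler01 N_ge1).
Qed.

Lemma t_le : t <= 1 / 100.
Proof. by apply: le_trans tN; rewrite ler_peMr ?N_ge1 // ltW. Qed.

Lemma x_bounds i : (i <= M)%N -> 1 <= x_ i /\ x_ i <= N.
Proof. by move=> iM; rewrite /abscissa ler1n ler_nat. Qed.

Lemma shifted_bounds i : (1 - t) * x_ i <= shifted i /\ shifted i <= (1 + t) * x_ i.
Proof.
have x0 : 0 <= x_ i by rewrite /abscissa ler0n.
have tx : 0 <= t * x_ i by rewrite mulr_ge0 ?(ltW t_gt0).
by rewrite /shifted; case: odd; split; lra.
Qed.

Lemma shifted_range i : (i <= M)%N -> 0 < shifted i /\ shifted i <= 2 * N.
Proof.
move=> iM; have [x1 x2] := x_bounds iM; have [s1 s2] := shifted_bounds i.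
have := t_le; have := t_gt0 => t0 t1.
have h1 : 0 < (1 - t) * x_ i by rewrite mulr_gt0 //; lra.
have h2 : (1 + t) * x_ i <= 2 * N by rewrite ler_pM //; lra.
by split; lra.
Qed.

Lemma shifted_lt i j : (i < j <= M)%N -> shifted i < shifted j.
Proof.
case/andP=> ij jM; have iM : (i <= M)%N by apply: leq_trans jM; apply: ltnW.
have [x1 x2] := x_bounds iM; have [y1 y2] := x_bounds jM.
have [_ s1] := shifted_bounds i; have [s2 _] := shifted_bounds j.
have xy : x_ i + 1 <= x_ j by exact: abscissa_lt.
have t0 := t_gt0; have tn := tN.
have h1 : t * x_ i <= t * N by rewrite ler_wpM2l // ltW.
have h2 : t * x_ j <= t * N by rewrite ler_wpM2l // ltW.
lra.
Qed.

Lemma example_close : close example (30 * N ^+ 2 * t).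
Proof.
move=> x; rewrite exampleE -/(x_ (col x)); have iM := col_le x; have [x1 x2] := x_bounds iM.
have [s1 s2] := shifted_range iM; have [s3 s4] := shifted_bounds (col x).
have t0 := t_gt0; have n1 := N_ge1.
have nn : N <= N ^+ 2 by rewrite expr2 ler_peMl // ltW // (lt_le_trans ltr01).
have h1 : t * x_ (col x) <= t * N ^+ 2 by rewrite ler_wpM2l ?(ltW t0) //; lra.
have h2 : t * x_ (col x) ^+ 2 <= t * N ^+ 2.
  by rewrite ler_wpM2l ?(ltW t0) // lerXn2r // nnegrE; lra.
have h3 : t * shifted (col x) ^+ 2 <= t * (2 * N) ^+ 2.
  by rewrite ler_wpM2l ?(ltW t0) // lerXn2r // nnegrE; lra.
have h4 : 0 <= t * x_ (col x) by rewrite mulr_ge0 // ltW.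
have h5 : 0 <= t * x_ (col x) ^+ 2 by rewrite mulr_ge0 ?sqr_ge0 // ltW.
have h6 : 0 <= t * shifted (col x) ^+ 2 by rewrite mulr_ge0 ?sqr_ge0 // ltW.
by case: (row x); rewrite /= ?mulr1n ?mulr0n !ler_norml; split; apply/andP; split; lra.
Qed.

(** This accounts for the cube in [t_small]: the tolerance is of order N^2 t and is multiplied by
    the width N. *)
Lemma example_eps : 30 * N ^+ 2 * t * N <= 1 / 100.
Proof. by have := t_small; rewrite [N ^+ 3]exprSr; lra. Qed.

(** For three points of a parabola the orientation is t times a Vandermonde product. *)
Lemma example_ccw : ccw example.
Proof.
apply: (ccw_of_rows example_eps example_close) => x y z rx ry rz /andP[h1 h2];
  rewrite !exampleE rx ry rz.
  have -> : orient (lower (col x)) (lower (col y)) (lower (col z)) =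
    t * (shifted (col y) - shifted (col x)) * (shifted (col z) - shifted (col x)) *
    (shifted (col z) - shifted (col y)) by rewrite /orient /=; ring.
  have [hy hz] := (col_le y, col_le z).
  by rewrite !mulr_gt0 ?t_gt0 // subr_gt0 shifted_lt // ?h1 ?h2 ?(ltn_trans h1 h2).
have -> : orient (upper (col x)) (upper (col y)) (upper (col z)) =
    t * (x_ (col x) - x_ (col y)) * (x_ (col x) - x_ (col z)) *
    (x_ (col y) - x_ (col z)) by rewrite /orient /=; ring.
by rewrite !mulr_gt0 ?t_gt0 // subr_gt0 /abscissa ltr_nat // ltnS (ltn_trans h1 h2).
Qed.

Lemma example_convex : convex_position example.
Proof.
have t0 := t_gt0; have n1 := N_ge1; have tn2 := tN2.
apply: convex_position_support => x; have iM := col_le x.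
have [x1 x2] := x_bounds iM; have [s1 s2] := shifted_range iM.
have neq y : y != x -> row y = row x -> col y != col x.
  by move=> yx r; apply: contra yx => /eqP c; rewrite -(gptK y) r c gptK.
case rx: (row x).
(* The tangent to the parabola at the point; at another point of the row the functional is t times
   the squared difference of abscissas. The lower row below is treated alike. *)
- exists (- (2 * t * x_ (col x)), -1, 1 + 20 * N ^+ 2 * t + t * x_ (col x) ^+ 2).
  rewrite exampleE rx /=; split; first by ring.
  move=> y yx; rewrite exampleE; have jM := col_le y.
  have [y1 y2] := x_bounds jM; have [r1 r2] := shifted_range jM.
  case ry: (row y) => /=.
    rewrite [X in 0 < X](_ : _ = t * (x_ (col x) - x_ (col y)) ^+ 2); last by ring.
    rewrite mulr_gt0 // lt0r sqr_ge0 sqrf_eq0 subr_eq0 /abscissa eqr_nat eqSS eq_sym neq //.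
    by rewrite rx ry.
  have h1 : t * (x_ (col x) * shifted (col y)) <= t * (N * (2 * N)).
    by rewrite ler_wpM2l ?(ltW t0) // ler_pM //; lra.
  have h2 : t * shifted (col y) ^+ 2 <= t * (2 * N) ^+ 2.
    by rewrite ler_wpM2l ?(ltW t0) // lerXn2r // nnegrE; lra.
  have h3 : 0 <= t * x_ (col x) ^+ 2 by rewrite mulr_ge0 ?sqr_ge0 // ltW.
  have h4 : 0 <= t * N ^+ 2 by rewrite mulr_ge0 ?sqr_ge0 // ltW.
  lra.
exists (- (2 * t * shifted (col x)), 1, t * shifted (col x) ^+ 2).
rewrite exampleE rx /=; split; first by ring.
move=> y yx; rewrite exampleE; have jM := col_le y.
have [y1 y2] := x_bounds jM; have [r1 r2] := shifted_range jM.
case ry: (row y) => /=.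
  have h1 : t * (shifted (col x) * x_ (col y)) <= t * ((2 * N) * N).
    by rewrite ler_wpM2l ?(ltW t0) // ler_pM //; lra.
  have h2 : t * x_ (col y) ^+ 2 <= t * N ^+ 2.
    by rewrite ler_wpM2l ?(ltW t0) // lerXn2r // nnegrE; lra.
  have h3 : 0 <= t * shifted (col x) ^+ 2 by rewrite mulr_ge0 ?sqr_ge0 // ltW.
  have h4 : 0 <= t * N ^+ 2 by rewrite mulr_ge0 ?sqr_ge0 // ltW.
  lra.
rewrite [X in 0 < X](_ : _ = t * (shifted (col x) - shifted (col y)) ^+ 2); last by ring.
rewrite mulr_gt0 // lt0r sqr_ge0 sqrf_eq0 subr_eq0 andbT.
have := neq y yx; rewrite rx ry => /(_ erefl); case: ltngtP => // lt _.
  by rewrite gt_eqF // shifted_lt // lt.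
by rewrite lt_eqF // shifted_lt // lt.
Qed.

Lemma sqd_lower i j : sqd (lower i) (lower j) =
  (shifted j - shifted i) ^+ 2 * (1 + t ^+ 2 * (shifted i + shifted j) ^+ 2).
Proof. by rewrite /sqd /=; ring. Qed.

Lemma sqd_upper i j : sqd (upper i) (upper j) =
  (x_ j - x_ i) ^+ 2 * (1 + t ^+ 2 * (x_ i + x_ j) ^+ 2).
Proof. by rewrite /sqd /=; ring. Qed.

Lemma curvature_le (u : R) : 0 <= u -> u <= 4 * N -> 1 + t ^+ 2 * u ^+ 2 <= 1 + t / 5.
Proof.
move=> u0 uN; rewrite lerD2l.
have h : u ^+ 2 <= (4 * N) ^+ 2 by rewrite lerXn2r // nnegrE //; have := N_ge1; lra.
have h1 : t * (t * u ^+ 2) <= t * (t * (4 * N) ^+ 2).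
  by rewrite !ler_wpM2l ?(ltW t_gt0).
have h2 : t * (t * N ^+ 2) <= t * (1 / 100) by rewrite ler_wpM2l ?tN2 ?(ltW t_gt0).
have := t_gt0; lra.
Qed.

(** By [shifted_bounds] the gap in the lower row is at most (1 - t) D for odd j and at least (1 + t)
    D for even j, whatever the parity of i; the curvature factor of at most 1 + t / 5 cannot
    compensate this. *)
Lemma jump_lengths i j : (i < j <= M)%N ->
  if odd j then sqd (lower i) (lower j) < sqd (upper i) (upper j)
  else sqd (upper i) (upper j) < sqd (lower i) (lower j).
Proof.
move=> ijM; have /andP[ij jM] := ijM; have iM : (i <= M)%N by apply: leq_trans jM; apply: ltnW.
have [x1 x2] := x_bounds iM; have [y1 y2] := x_bounds jM.
have [s1 s2] := shifted_range iM; have [r1 r2] := shifted_range jM.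
have [b1 b2] := shifted_bounds i; have lt := shifted_lt ijM.
have t0 := t_gt0; have t1 := t_le.
have xy : x_ i + 1 <= x_ j by exact: abscissa_lt.
rewrite sqd_lower sqd_upper; set D := x_ j - x_ i.
have D2 : 0 < D ^+ 2 by rewrite exprn_gt0 // subr_gt0; lra.
case: ifP => oj.
- have hX : shifted j - shifted i <= (1 - t) * D by rewrite /D {1}/shifted oj; lra.
  have hX2 : (shifted j - shifted i) ^+ 2 <= (1 - t) ^+ 2 * D ^+ 2.
    rewrite -exprMn lerXn2r // nnegrE; first by lra.
    by rewrite mulr_ge0 //; [lra | rewrite /D; lra].
  have c1 : 1 + t ^+ 2 * (shifted i + shifted j) ^+ 2 <= 1 + t / 5.
    by apply: curvature_le; lra.
  apply: le_lt_trans (ler_pM _ _ hX2 c1) _; rewrite ?sqr_ge0 //.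
    by rewrite addr_ge0 // mulr_ge0 ?sqr_ge0.
  apply: (@lt_le_trans _ _ (D ^+ 2)); last first.
    by rewrite ler_pMr // lerDl mulr_ge0 ?sqr_ge0.
  rewrite mulrAC gtr_pMl //.
  have : t * t <= t * (1 / 100) by rewrite ler_wpM2l // ltW.
  have : 0 <= t * t by rewrite mulr_ge0 // ltW.
  have : t * t * t <= t * t * (1 / 100) by rewrite ler_wpM2l // mulr_ge0 // ltW.
  lra.
- have hX : (1 + t) * D <= shifted j - shifted i by rewrite /D {1}/shifted oj; lra.
  have hX2 : (1 + t) ^+ 2 * D ^+ 2 <= (shifted j - shifted i) ^+ 2.
    rewrite -exprMn lerXn2r // nnegrE; last by lra.
    by rewrite mulr_ge0 //; [lra | rewrite /D; lra].
  have c1 : 1 + t ^+ 2 * (x_ i + x_ j) ^+ 2 <= 1 + t / 5.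
    by apply: curvature_le; lra.
  apply: (@lt_le_trans _ _ ((1 + t) ^+ 2 * D ^+ 2)); last first.
    apply: le_trans hX2 _; rewrite ler_peMr ?sqr_ge0 // lerDl mulr_ge0 ?sqr_ge0 //.
  rewrite mulrC ltr_pM2r //; apply: le_lt_trans c1 _.
  have : 0 <= t * t by rewrite mulr_ge0 // ltW.
  lra.
Qed.

Lemma vertical_lengths i : (i < M)%N ->
  [/\ sqd (lower i) (lower i.+1) < sqd (lower i) (upper i),
      sqd (upper i) (upper i.+1) < sqd (lower i) (upper i) &
      sqd (lower i.+1) (upper i.+1) < sqd (lower i) (upper i)].
Proof.
move=> lM; have iM := ltnW lM.
have [x1 x2] := x_bounds iM; have [y1 y2] := x_bounds lM.
have [s1 s2] := shifted_range iM; have [r1 r2] := shifted_range lM.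
have [b1 b2] := shifted_bounds i; have [d1 d2] := shifted_bounds i.+1.
have t0 := t_gt0; have t1 := t_le; have tn2 := tN2; have n1 := N_ge1; have tn := tN.
have ey := abscissaS i.
have lt : shifted i < shifted i.+1 by apply: shifted_lt; rewrite ltnSn.
pose x := x_ i; rewrite -/x in x1 x2 b1 b2 ey.
have tx : t * x <= t * N by rewrite ler_wpM2l // ltW.
have tle : t <= t * N by rewrite ler_peMr // ltW.
have nn : t * N <= t * N ^+ 2 by rewrite ler_wpM2l ?(ltW t0) // expr2 ler_peMl //; lra.
(* The height of the vertical edge in column i; the two parabolas take at most 5 N^2 t from the
   extra 20 N^2 t. *)
pose h := 1 + 20 * N ^+ 2 * t - t * x ^+ 2 - t * shifted i ^+ 2.
have tx2 : t * x ^+ 2 <= t * N ^+ 2.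
  by rewrite ler_wpM2l ?(ltW t0) // lerXn2r // nnegrE; lra.
have tX2 : t * shifted i ^+ 2 <= t * (2 * N) ^+ 2.
  by rewrite ler_wpM2l ?(ltW t0) // lerXn2r // nnegrE; lra.
have hge : 1 + 15 * (t * N ^+ 2) <= h by rewrite /h; lra.
have tn0 : 0 < t * N ^+ 2 by rewrite mulr_gt0 // exprn_gt0 //; lra.
have h2 : 1 + 30 * (t * N ^+ 2) <= h ^+ 2.
  have : (1 + 15 * (t * N ^+ 2)) ^+ 2 <= h ^+ 2 by rewrite lerXn2r // nnegrE; lra.
  have : 0 <= (t * N ^+ 2) ^+ 2 by rewrite sqr_ge0.
  lra.
have vE : sqd (lower i) (upper i) = (shifted i - x) ^+ 2 + h ^+ 2.
  by rewrite /sqd /h /x /=; ring.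
have v1 : 1 + 30 * (t * N ^+ 2) <= sqd (lower i) (upper i).
  by rewrite vE; have := sqr_ge0 (shifted i - x); lra.
split.
- apply: lt_le_trans v1; rewrite sqd_lower.
  have c1 : 1 + t ^+ 2 * (shifted i + shifted i.+1) ^+ 2 <= 1 + t / 5.
    by apply: curvature_le; lra.
  have hX : shifted i.+1 - shifted i <= 1 + 3 * (t * N) by lra.
  have hX2 : (shifted i.+1 - shifted i) ^+ 2 <= (1 + 3 * (t * N)) ^+ 2.
    by rewrite lerXn2r // nnegrE; lra.
  apply: le_lt_trans (ler_pM _ _ hX2 c1) _; rewrite ?sqr_ge0 //.
    by rewrite addr_ge0 // mulr_ge0 ?sqr_ge0.
  have q1 : (t * N) * (t * N) <= (t * N) * (1 / 100) by rewrite ler_wpM2l //; lra.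
  have q2 : (1 + 3 * (t * N)) ^+ 2 <= 1 + 7 * (t * N) by lra.
  have q3 : (1 + 3 * (t * N)) ^+ 2 * (1 + t / 5) <= (1 + 7 * (t * N)) * (1 + t / 5).
    by rewrite ler_wpM2r //; lra.
  have q4 : t * N * t <= t * N * (1 / 100) by rewrite ler_wpM2l //; lra.
  lra.
- apply: lt_le_trans v1; rewrite sqd_upper ey /x.
  have -> : x_ i + 1 - x_ i = 1 :> R by ring.
  rewrite expr1n mul1r; apply: le_lt_trans (curvature_le _ _) _; lra.
rewrite vE.
pose h' := 1 + 20 * N ^+ 2 * t - t * (x + 1) ^+ 2 - t * shifted i.+1 ^+ 2.
have -> : sqd (lower i.+1) (upper i.+1) = (shifted i.+1 - (x + 1)) ^+ 2 + h' ^+ 2.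
  by rewrite /sqd /h' /= ey; ring.
have e1 : (shifted i.+1 - (x + 1)) ^+ 2 = t ^+ 2 * (x + 1) ^+ 2.
  by rewrite /shifted ey; case: odd; ring.
have e0 : (shifted i - x) ^+ 2 = t ^+ 2 * x ^+ 2.
  by rewrite /shifted -/x; case: odd; ring.
rewrite e0 e1.
have sq : shifted i ^+ 2 <= shifted i.+1 ^+ 2 by rewrite lerXn2r // ?nnegrE; lra.
have tsq : t * shifted i ^+ 2 <= t * shifted i.+1 ^+ 2 by rewrite ler_wpM2l // ltW.
have dh : h' + t * (2 * x + 1) <= h by rewrite /h /h'; lra.
have h'0 : 0 <= h'.
  have : t * shifted i.+1 ^+ 2 <= t * (2 * N) ^+ 2.
    by rewrite ler_wpM2l ?(ltW t0) // lerXn2r // nnegrE; lra.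
  have : t * (x + 1) ^+ 2 <= t * N ^+ 2.
    by rewrite ler_wpM2l ?(ltW t0) // lerXn2r // ?nnegrE -?ey //; lra.
  by rewrite /h'; lra.
have p0 : 0 < t * (2 * x + 1) by rewrite mulr_gt0 //; lra.
(* The squared heights differ by at least t (2 x + 1), while the squared horizontal offset grows
   only by t^2 (2 x + 1). *)
have g1 : t * (2 * x + 1) * 1 <= (h - h') * (h + h') by rewrite ler_pM //; lra.
have g2 : t * (2 * x + 1) * t < t * (2 * x + 1) * 1 by rewrite ltr_pM2l //; lra.
lra.
Qed.

End Example.

Arguments example : simpl never.

(** * Tightness of the trees of the example *)

Section ExampleTrees.
Variables (R : realType) (M : nat) (t : R).
Local Notation I := ('I_M.+1 + 'I_M.+1)%type.
Hypothesis t_gt0 : 0 < t.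
Hypothesis t_small : t * abscissa R M ^+ 3 <= 1 / 100 * (1 / 100).
Local Notation p := (@example R M t).
Implicit Types (S : {set I}) (E : {set {set I}}).

Lemma example_gpt a i : (i <= M)%N -> p (gpt M a i) = if a then upper M t i else lower t i.
Proof. by move=> iM; rewrite exampleE row_gpt col_gpt. Qed.

Lemma example_jump i j : (i < j <= M)%N ->
  dist (p (gpt M (~~ odd j) i)) (p (gpt M (~~ odd j) j)) <
  dist (p (gpt M (odd j) i)) (p (gpt M (odd j) j)).
Proof.
move=> ijM; have /andP[ij jM] := ijM; have iM : (i <= M)%N by apply: leq_trans (ltnW ij) jM.
rewrite !example_gpt //; apply: dist_lt_sqd.
by have := jump_lengths t_gt0 t_small ijM; case: odd.
Qed.

Lemma example_tight S E e : is_mst p S E -> e \in E -> tight_edge S e.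
Proof.
move=> mE eE; have pc := example_close t_gt0 t_small.
have pe := example_eps t_small.
have [a [i [b [j [ee jM g]]]]] := mst_good pe pc mE eE.
have [ij [aS bS] _ _ vert] := g; have iM := leq_trans ij jM.
exists a, i, b, j; split=> //; split=> //.
- move=> eij iltM; subst j; have [ea eb] := vert erefl; subst a b e.
  apply/negP=> /andP[vS wS]; have [l1 l2 l3] := vertical_lengths t_gt0 t_small iltM.
  (* The detour follows both rows and the vertical edge of the next column. *)
  apply: (@mst_no_shortcut _ _ p S E _ _ [:: gpt M false i.+1; gpt M true i.+1; gpt M true i]
    mE eE) => //=.
  rewrite !example_gpt // aS bS vS wS /= (dist_sym (upper M t i.+1)).
  by rewrite !dist_lt_sqd.
- move=> eab lt aiS ajS; subst b e.
  apply/eqP/negPn/negP=> ne; have {}ne : a = odd j by case: (a) ne; case: odd.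
  have ltij : (i < j <= M)%N by rewrite (ltnW lt) jM.
  (* The detour uses the jump in the other row and two vertical edges, which are shorter than any
     jump over at least two steps. *)
  apply: (@mst_no_shortcut _ _ p S E _ _ [:: gpt M (~~ a) i; gpt M (~~ a) j; gpt M a j]
    mE eE) => //=.
  have vert_lt k : (k <= M)%N -> forall c d, c != d ->
      dist (p (gpt M c k)) (p (gpt M d k)) < dist (p (gpt M a i)) (p (gpt M a j)).
    move=> kM c d cd; apply: (dist_lt_gsqd pe pc).
    rewrite /gsqd !col_gpt // !row_gpt cd eqxx subnn /=.
    by clear -lt; rewrite -!mulnn; nia.
  rewrite aS bS aiS ajS /= !vert_lt //=; try by case: (a).
  by rewrite ne example_jump.
Qed.

Lemma example_generic : generic p.
Proof.
split; first exact: ccw_general_position (example_ccw t_gt0 t_small).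
by move=> S; apply: unique_mst_of_tight => E e; apply: example_tight.
Qed.

Lemma example_cr : (cr p <= (5 * M) %/ 4)%N.
Proof.
apply: cr_le => S ER EB mR mB.
apply: (@crossings_upper_bound R M p (example_ccw t_gt0 t_small)
  (fun a i => gpt M a i \in S) (fun c => if c then ER else EB)).
case=> e eE.
  have [a [i [b [j [ee jM g]]]]] := example_tight mR eE.
  exists a, i, b, j; split=> //; rewrite /tight.
  rewrite [X in tight_good M X](_ : _ = (fun a i => gpt M a i \in S)) //.
  by apply/funext => c; apply/funext => k; rewrite eqb_id.
have [a [i [b [j [ee jM g]]]]] := example_tight mB eE.
exists a, i, b, j; split=> //; rewrite /tight.
rewrite [X in tight_good M X](_ : _ = (fun a i => gpt M a i \in ~: S)) //.
by apply/funext => c; apply/funext => k; rewrite in_setC eqbF_neg.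
Qed.

End ExampleTrees.

(** * Choice of the tolerance and of the perturbation parameter *)

Unset Implicit Arguments.

Theorem theorem5 (R : realType) (n : nat) :
  (2 <= n)%N -> ~~ odd n ->
  (exists eps : R, 0 < eps /\
     forall v w : 'I_(n./2) -> R * R,
       near_grid eps v w ->
       injective (grid_pts v w) ->
       generic (grid_pts v w) ->
       convex_position (grid_pts v w) ->
       ((5 * (n - 2)) %/ 8 <= cr (grid_pts v w))%N)
  /\
  (forall eps : R, 0 < eps ->
     exists v w : 'I_(n./2) -> R * R,
       [/\ near_grid eps v w,
           injective (grid_pts v w),
           generic (grid_pts v w),
           convex_position (grid_pts v w) &
           (cr (grid_pts v w) <= (5 * (n - 2)) %/ 8)%N]).
Proof.
(* M is the number of steps between neighbouring columns, so n - 2 = 2 M. *)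
move=> n2 on; have [M eM] : exists M, n./2 = M.+1.
  by exists n./2.-1; rewrite prednK // half_gt0.
have -> : ((5 * (n - 2)) %/ 8 = (5 * M) %/ 4)%N.
  have -> : (n - 2 = M * 2)%N by have := odd_double_half n; rewrite (negbTE on) eM; lia.
  by rewrite mulnA (@divnMr 2 (5 * M) 4).
rewrite eM {n n2 on eM}; split.
  have N0 : 0 < 100 * M.+1%:R :> R by rewrite mulr_gt0 ?ltr0n.
  have N1 : M.+1%:R != 0 :> R by rewrite pnatr_eq0.
  exists (100 * M.+1%:R)^-1; split; first by rewrite invr_gt0.
  move=> v w near _ [gp uniq] cvx; have pc := near_grid_close near.
  have es : (100 * M.+1%:R)^-1 * M.+1%:R <= 1 / 100 :> R.
    by rewrite invfM -mulrA mulVf // mulr1 div1r.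
  exact: cr_lower_bound es pc (convex_ccw es pc cvx) uniq.
move=> eps eps0; set N := abscissa R M.
have N1 : 1 <= N := N_ge1 R M.
have N0 : 0 < N := lt_le_trans ltr01 N1.
(* The first bound gives [t_small]. In the second, 60 is twice the constant of [example_close],
   since a distance is at most the sum of two coordinate deviations. *)
pose t := Num.min (1 / 100 * (1 / 100) / N ^+ 3) (eps / (60 * N ^+ 2)).
have t0 : 0 < t.
  by rewrite lt_min; apply/andP; split; apply: divr_gt0; rewrite ?mulr_gt0 ?exprn_gt0 //; lra.
have ts : t * N ^+ 3 <= 1 / 100 * (1 / 100).
  by rewrite -ler_pdivlMr ?exprn_gt0 // ge_min lexx.
have te : 2 * (30 * N ^+ 2 * t) <= eps.
  have : t <= eps / (60 * N ^+ 2) by rewrite ge_min lexx orbT.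
  by rewrite ler_pdivlMr ?mulr_gt0 ?exprn_gt0 ?ltr0n //; lra.
exists (fun i : 'I_M.+1 => lower t i), (fun i : 'I_M.+1 => upper M t i); split.
- by move=> i; have [h1 h2] := close_near_grid (example_close t0 ts) i; split; apply: le_trans te.
- exact: close_injective (example_eps ts) (example_close t0 ts).
- exact: example_generic.
- exact: example_convex.
- exact: example_cr.
Qed.
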